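(* Let $\mathcal G=(V,E)$ be a finite graph with two distinct marked vertices $N$ and $F$ that are connected by a path in $\mathcal G$. Let $\mathcal E\subset[0,1]^E$, $p_e$ ($e\in E$) and $Q=(Q_e)_{e\in E}$ be as defined in the context, let $(\mathbf W(n))_{n\ge0}$ be the edge-weights of the trace-reinforced ant process on $\mathcal G$, $\mathcal F_n=\sigma(\mathbf W(0),\dots,\mathbf W(n))$, and $\mathbf X(n)=(X_e(n))_{e\in E}$ with $X_e(n)=\frac{W_e(n)}{n+1}$. Then the function $Q$ is Lipschitz on $\mathcal E$, and the process $(\mathbf X(n))_{n\ge0}$ is a stochastic approximation on $\mathcal E$ (with respect to $(\mathcal F_n)_{n\ge 0}$). More precisely, for all $n\ge0$, $\mathbf X(n)\in\mathcal E$ and \[\mathbf X(n+1)=\mathbf X(n)+\frac1{n+2}\big(Q(\mathbf X(n))+\boldsymbol\xi(n+1)\big),\] where, for any $e\in E$, $\xi_e(n+1)=\mathbf 1\{W_e(n+1)=W_e(n)+1\}-p_e(\mathbf X(n))$.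
   Context: Trace-reinforced ant process. Let $\mathcal G=(V,E)$ be a finite undirected graph (parallel edges allowed, each copy carrying its own weight) with two distinct marked nodes $N$ and $F$. Random weights $\mathbf W(n)=(W_e(n))_{e\in E}$, $n\ge 0$, are defined recursively. At time $0$, $W_e(0)=1$ for all $e\in E$. Given $\mathbf W(n)$ (and independently of the rest of the past), run a random walk on $\mathcal G$ started at $N$ and stopped when it first hits $F$; at each step, from a vertex $u\ne F$, it crosses an edge $e$ incident to $u$ with probability $W_e(n)/\sum_{e'\sim u}W_{e'}(n)$, where the sum is over the edges $e'$ incident to $u$ (the weights being kept fixed equal to $\mathbf W(n)$ during the whole walk). Let $\gamma(n+1)$ be the set of edges crossed at least once by this walk (its trace), and set $W_e(n+1)=W_e(n)+\mathbf 1_{e\in\gamma(n+1)}$ for all $e\in E$. For $\boldsymbol w\in[0,1]^E$ and $x\in V$, $\pi_{\boldsymbol w}(x)=\sum_{e\sim x}w_e$ (sum over edges having $x$ as endpoint). Let $\mathfrak c_1,\dots,\mathfrak c_{\mathfrak S}$ be the self-avoiding paths from $N$ to $F$ in $\mathcal G$, $\mathfrak S=\mathfrak S(\mathcal G)$ being their number. For $1\le i\le\mathfrak S$ let \[\mathcal E_i=\Big\{\boldsymbol w\in[0,1]^E:\ \pi_{\boldsymbol w}(N)\ge1\ \text{and}\ w_e\ge\tfrac1{\mathfrak S}\text{ for all }e\in\mathfrak c_i\Big\},\] and let $\mathcal E=\mathrm{conv}\big(\bigcup_{i=1}^{\mathfrak S}\mathcal E_i\big)$ (convex hull), a convex compact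 subset of $[0,1]^E$. For $\boldsymbol w\in\mathcal E$ and $e\in E$, $p_e(\boldsymbol w)$ is the probability that $e$ belongs to the trace (set of edges crossed at least once) of the random walk on $\mathcal G$ with edge-weights $\boldsymbol w$ (transition probabilities proportional to the weights), started from $N$ and killed when it hits $F$; and $Q_e(\boldsymbol w)=p_e(\boldsymbol w)-w_e$. Stochastic approximation: a process $(X_n)_{n\ge0}$ adapted to a filtration $(\mathcal F_n)_{n\ge0}$, with values in a convex compact subset $\mathcal E\subseteq\mathbb R^d$, such that for all $n\ge0$, $X_{n+1}=X_n+\frac{Q(X_n)+\xi_{n+1}+r_n}{n+2}$, where $Q:\mathcal E\to\mathbb R^d$ is Lipschitz, $\xi_{n+1}$ is $\mathcal F_{n+1}$-measurable with $\mathbb E[\xi_{n+1}\mid\mathcal F_n]=0$, and $r_n$ is $\mathcal F_n$-measurable with almost surely $\|r_n\|\le C/n$ (for $n\ge1$) for some deterministic constant $C>0$. *)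

(* Defs.v *)
From HB Require Import structures.
From mathcomp Require Import all_boot all_order all_algebra.
From mathcomp Require Import all_classical all_reals all_analysis.

Set Implicit Arguments.
Unset Strict Implicit.
Unset Printing Implicit Defensive.

Import Order.TTheory GRing.Theory Num.Theory.
Import numFieldNormedType.Exports.

Local Open Scope classical_set_scope.
Local Open Scope ring_scope.

(* A finite undirected multigraph with vertex set V is given by the map sending
   each of its d edges to its two endpoints; the order of the two components of
   [ends e] plays no role.  R^E is 'rV[R]_d, with the sup norm. *)
Section Graph.
Context {V : finType} {d : nat}.
Variables (ends : 'I_d -> V * V) (N F : V).

Definition incident (e : 'I_d) (u : V) : bool :=
  (u == (ends e).1) || (u == (ends e).2).

(* The endpoint of [e] reached when [e] is crossed from its endpoint [u]. *)
Definition cross (u : V) (e : 'I_d) : V :=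
  if u == (ends e).1 then (ends e).2 else (ends e).1.

Definition visited (u : V) (s : seq 'I_d) : seq V := u :: scanl cross u s.

Fixpoint edge_path (u : V) (s : seq 'I_d) : bool :=
  if s is e :: s' then incident e u && edge_path (cross u e) s' else true.

Definition path_between (u v : V) (s : seq 'I_d) : bool :=
  edge_path u s && (foldl cross u s == v).

(* Paths are sequences of edges, so paths using different parallel edges are
   different.  A self-avoiding path has fewer than #|V| edges, hence all of them
   are captured by sequences of length at most #|V|. *)
Definition self_avoiding_paths : {set {bseq #|V| of 'I_d}} :=
  [set c : {bseq #|V| of 'I_d} | path_between N F c && uniq (visited N c)]%SET.

Section Weights.
Context {R : realType}.
Implicit Types w : 'rV[R]_d.

Definition vertex_weight w (x : V) : R := \sum_(e | incident e x) w ord0 e.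

Definition E_path (c : seq 'I_d) : set 'rV[R]_d :=
  [set w : 'rV[R]_d | [/\ forall e, 0 <= w ord0 e <= 1, 1 <= vertex_weight w N &
           forall e, e \in c -> #|self_avoiding_paths|%:R^-1 <= w ord0 e]].

Definition convex_hull (A : set 'rV[R]_d) : set 'rV[R]_d :=
  smallest (@convex_set R 'rV[R]_d) A.

Definition E_hull : set 'rV[R]_d :=
  convex_hull
    (\bigcup_(c in [set c | c \in self_avoiding_paths]) E_path c).

(* The outcome of one step of the walk is [Some e] if the edge [e] is crossed,
   and [None] if the walk has already been killed at [F]. *)
Definition step_prob w (u : V) (o : option 'I_d) : R :=
  match o with
  | Some e =>
      if (u != F) && incident e u then w ord0 e / vertex_weight w u else 0
  | None => (u == F)%:R
  end.

Definition next_vertex (u : V) (o : option 'I_d) : V :=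
  if o is Some e then cross u e else u.

(* Probability that the first [size s] steps of the walk started at [u] are
   given by [s]. *)
Fixpoint traj_prob w (u : V) (s : seq (option 'I_d)) : R :=
  if s is o :: s' then step_prob w u o * traj_prob w (next_vertex u o) s'
  else 1.

Definition trace (s : nat -> option 'I_d) : set 'I_d :=
  [set e | exists k, s k = Some e].

(* The event that [e] is in the trace is the increasing union over k of the
   events that [e] is crossed during the first k steps; see
   [random_walk_trace] below. *)
Definition trace_prob w (e : 'I_d) : R :=
  limn (fun k => \sum_(s : k.-tuple (option 'I_d) | Some e \in val s)
                   traj_prob w N s).

Definition Q w : 'rV[R]_d := \row_e (trace_prob w e - w ord0 e).

End Weights.

Section Process.
Context {R : realType} {dsp : measure_display} {T : measurableType dsp}.
Variable P : probability T R.

Definition cylinder (step : nat -> T -> option 'I_d) (s : seq (option 'I_d)) :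
    set T :=
  [set t | mkseq (fun k => step k t) (size s) = s].

Definition random_walk (w : 'rV[R]_d) (step : nat -> T -> option 'I_d) : Prop :=
  (forall k o, measurable (step k @^-1` [set o])) /\
  (forall s, P (cylinder step s) = (traj_prob w N s)%:E).

Lemma random_walk_trace (w : 'rV[R]_d) (step : nat -> T -> option 'I_d)
    (e : 'I_d) :
  random_walk w step ->
  P [set t | trace (fun k => step k t) e] = (trace_prob w e)%:E.
Proof.
move=> [mstep law].
have mcyl s : measurable (cylinder step s).
  have -> : cylinder step s =
      \bigcap_(i in `I_(size s)) (step i @^-1` [set nth None s i]).
    apply/seteqP; split=> t /=.
      by move=> eqs i /= ilt; rewrite -[in RHS]eqs nth_mkseq.
    move=> H; apply: (@eq_from_nth _ None); rewrite size_mkseq// => i ilt.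
    by rewrite nth_mkseq//; exact: H.
  by apply: bigcap_measurableType => // i _; exact: mstep.
pose B k := [set t | Some e \in mkseq (fun k => step k t) k].
have BE k : B k =
    \big[setU/set0]_(s : k.-tuple (option 'I_d) | Some e \in val s)
      cylinder step s.
  apply/seteqP; split=> t.
    rewrite /B /= => et.
    have sz : size (mkseq (fun k => step k t) k) == k by rewrite size_mkseq.
    rewrite (bigD1 (Tuple sz)) //=; left.
    by rewrite /cylinder /= size_mkseq.
  elim/big_ind: _ => //= [A1 A2 h1 h2 [/h1|/h2] //|s es].
  by rewrite /cylinder /B /= size_tuple => ->.
have PB k : P (B k) =
    (\sum_(s : k.-tuple (option 'I_d) | Some e \in val s) traj_prob w N s)%:E.
  rewrite BE -sumEFin; under [RHS]eq_bigr => s _ do rewrite -law.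
  elim: (index_enum _) (index_enum_uniq (k.-tuple (option 'I_d)))
    => [_|s r IH /= /andP[sr ur]]; first by rewrite !big_nil measure0.
  rewrite !big_cons; case: ifP => [_|_]; last exact: IH.
  rewrite measureU //; [exact: congr1 (IH ur)|exact: bigsetU_measurable|].
  rewrite -subset0 => t [st]; rewrite big_seq_cond.
  elim/big_ind: _ => //= [A1 A2 h1 h2 [/h1|/h2] //|s' /andP[s'r _]].
  move: st; rewrite /cylinder /= !size_tuple => -> /val_inj ss'.
  by rewrite ss' s'r in sr.
have mB k : measurable (B k).
  by rewrite BE; apply: bigsetU_measurable.
have -> : [set t | trace (fun k => step k t) e] = \bigcup_k B k.
  apply/seteqP; split=> t /=.
    move=> [k ek]; exists k.+1 => //; rewrite /B /=; apply/mapP; exists k => //.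
    by rewrite mem_iota /= add0n.
  by move=> [k _]; rewrite /B /= => /mapP[i _ ei]; exists i.
have ndB : nondecreasing_seq B.
  move=> k l kl; apply/subsetPset => t; rewrite /B /= => /mapP[i].
  rewrite mem_iota /= add0n => ik ei; apply/mapP; exists i => //.
  by rewrite mem_iota /= add0n (leq_trans ik).
have mUB : measurable (\bigcup_k B k) by exact: bigcup_measurable.
have fP := fin_num_measure P _ mUB.
rewrite /trace_prob -(fineK fP); congr (_%:E); apply/esym/cvg_lim => //.
have /fine_cvg : P \o B @ \oo --> (fine (P (\bigcup_k B k)))%:E.
  by rewrite (fineK fP); exact: nondecreasing_cvg_mu.
by apply: cvg_trans; apply: near_eq_cvg; apply: nearW => k /=; rewrite PB.
Qed.

Definition natural_filtration (W : nat -> T -> 'rV[R]_d) (n : nat) :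
    set (set T) :=
  <<s [set A | exists m e (B : set R), [/\ (m <= n)%N, measurable B &
                 A = (fun t => W m t ord0 e) @^-1` B]] >>.

(* [step n] is the sequence of steps of the walk run with weights [W n], whose
   trace is gamma(n+1).  The last clause says that, given [W n] and
   independently of the rest of the past, this walk is a random walk with
   weights [W n] started at [N] and killed at [F]. *)
Definition trace_reinforced_ant (W : nat -> T -> 'rV[R]_d)
    (step : nat -> nat -> T -> option 'I_d) : Prop :=
  [/\ forall t, W 0%N t = const_mx 1,
      forall n t e,
        W n.+1 t ord0 e = W n t ord0 e + \1_(trace (fun k => step n k t)) e,
      forall n k o, measurable (step n k @^-1` [set o]) &
      forall n A w s, natural_filtration W n A ->
        P (A `&` (W n @^-1` [set w]) `&` cylinder (step n) s) =
        (P (A `&` (W n @^-1` [set w])) * (traj_prob w N s)%:E)%E].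

Definition rescaled (W : nat -> T -> 'rV[R]_d) (n : nat) (t : T) : 'rV[R]_d :=
  n.+1%:R^-1 *: W n t.

Definition measurable_wrt (G : set (set T)) (f : T -> R) : Prop :=
  forall B, measurable B -> G (f @^-1` B).

Definition is_cond_exp (G : set (set T)) (X Y : T -> R) : Prop :=
  [/\ P.-integrable setT (EFin \o X), P.-integrable setT (EFin \o Y),
      measurable_wrt G Y &
      forall A, G A ->
        (\int[P]_(t in A) (X t)%:E = \int[P]_(t in A) (Y t)%:E)%E].

Definition filtration (Fil : nat -> set (set T)) : Prop :=
  [/\ forall n, sigma_algebra setT (Fil n),
      forall n, Fil n `<=` measurable &
      forall m n, (m <= n)%N -> Fil m `<=` Fil n].

(* The value [xi 0] is irrelevant. *)
Definition sa_decomposition (Fil : nat -> set (set T)) (K : set 'rV[R]_d)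
    (q : 'rV[R]_d -> 'rV[R]_d) (X xi r : nat -> T -> 'rV[R]_d) : Prop :=
  [/\ filtration Fil /\
        (forall n e, measurable_wrt (Fil n) (fun t => X n t ord0 e)),
      [/\ @convex_set R 'rV[R]_d K, compact K,
          forall n, {ae P, forall t, K (X n t)} & [lipschitz q w | w in K]],
      forall n e,
        measurable_wrt (Fil n.+1) (fun t => xi n.+1 t ord0 e) /\
        is_cond_exp (Fil n) (fun t => xi n.+1 t ord0 e) (cst 0),
      (forall n e, measurable_wrt (Fil n) (fun t => r n t ord0 e)) /\
        (exists2 C : R, 0 < C & forall n, (0 < n)%N ->
           {ae P, forall t, `|r n t| <= C / n%:R}) &
      forall n t,
        X n.+1 t = X n t + n.+2%:R^-1 *: (q (X n t) + xi n.+1 t + r n t)].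

Definition stochastic_approximation (Fil : nat -> set (set T))
    (K : set 'rV[R]_d) (q : 'rV[R]_d -> 'rV[R]_d) (X : nat -> T -> 'rV[R]_d) :
    Prop :=
  exists xi r, sa_decomposition Fil K q X xi r.

End Process.
End Graph.

Arguments E_hull {V d} ends N F R.

(* Main.v *)
Require Import Defs.
From mathcomp Require Import all_boot all_order all_algebra.
From mathcomp Require Import all_classical all_reals all_analysis.
From mathcomp Require Import measurable_realfun ring lra.
Import Order.TTheory GRing.Theory Num.Theory.
Import numFieldNormedType.Exports.
Local Open Scope classical_set_scope.
Local Open Scope ring_scope.

Set Implicit Arguments.
Unset Strict Implicit.
Unset Printing Implicit Defensive.

(* Lipschitz continuity.  1 - p_e(w) is the limit m_w(N) of the probabilities
   of avoiding e during k steps, and m_w is harmonic off F for the Laplacian L_w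
   of the graph killed on e.  L_w is symmetric, so if g is its Green function
   with pole N and f = m_w - m_w', then
   f(N) = sum_x f(x) L_w g(x) = sum_x g(x) L_w f(x)
        = - sum_x g(x) (L_w - L_w') m_w'(x),
   which is at most C |w - w'| as soon as g is bounded uniformly in w.  On the
   hull some path from N to F carries weights bounded below, so the walk reaches
   F before returning to N with probability bounded below, and the expected
   number of visits to N, hence g, is bounded.  No lower bound on the other
   weights is needed.

   Invariance of the hull.  X(n+1) is a convex combination of X(n) and of the
   indicator of the trace.  The walk hits F almost surely, so its trace contains
   a self-avoiding path c_i, and its indicator lies in E_i.

   Martingale increments.  W(n) takes finitely many values, so conditioning on
   W(n) = w and on a past event reduces to the law of a single walk. *)

(** * Edge paths and loop erasure *)

Section LoopErasure.
Context {V : finType} {d : nat}.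
Variable ends : 'I_d -> V * V.

Lemma incident_cross u e : incident ends e u -> incident ends e (cross ends u e).
Proof.
by rewrite /incident /cross; case: ifP => _; rewrite eqxx ?orbT.
Qed.

Lemma visited_cons u e s :
  visited ends u (e :: s) = u :: visited ends (cross ends u e) s.
Proof. by []. Qed.

Lemma size_visited u s : size (visited ends u s) = (size s).+1.
Proof. by rewrite /visited /= size_scanl. Qed.

Lemma path_suffix u x y s : path_between ends x y s ->
  uniq (visited ends x s) -> u \in visited ends x s ->
  exists s', [/\ path_between ends u y s', uniq (visited ends u s')
               & {subset s' <= s}].
Proof.
elim: s x => [|e s IH] x.
  rewrite inE => ps us /eqP ->; by exists [::].
rewrite /path_between [edge_path _ _ _]/= [foldl _ _ _]/= visited_cons.
move=> /andP[/andP[ie ps] fs] ux.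
rewrite inE => /predU1P[->|uv].
  exists (e :: s); split=> //.
  by rewrite /path_between /= ie ps fs.
move: ux; rewrite cons_uniq => /andP[_ ux].
have [|s' [h1 h2 h3]] := IH (cross ends x e) _ ux uv.
  by rewrite /path_between ps fs.
by exists s'; split=> // z /h3 zs; rewrite inE zs orbT.
Qed.

(** Loops are erased from the end backwards: once the tail is loop-free, the first edge is prepended
    if [u] is new, and otherwise the tail is cut at its visit to [u] by [path_suffix]. *)
Lemma loop_erasure u v s : path_between ends u v s ->
  exists s', [/\ path_between ends u v s', uniq (visited ends u s')
               & {subset s' <= s}].
Proof.
elim: s u => [|e s IH] u; first by move=> h; exists [::].
rewrite /path_between /= => /andP[/andP[ie ps] fs].
have [|s' [h1 h2 h3]] := IH (cross ends u e); first by rewrite /path_between ps.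
have [uv|uv] := boolP (u \in visited ends (cross ends u e) s').
  have [s2 [k1 k2 k3]] := path_suffix h1 h2 uv.
  by exists s2; split=> // z /k3/h3 zs; rewrite inE zs orbT.
have k2 : uniq (visited ends u (e :: s')) by rewrite visited_cons cons_uniq uv h2.
exists (e :: s'); split=> //; last first.
- by move=> z; rewrite !inE => /predU1P[->|/h3->]; rewrite ?eqxx ?orbT.
- by move: h1; rewrite /path_between /= ie.
Qed.

Lemma self_avoiding_subpath N F s : path_between ends N F s ->
  exists2 c, c \in self_avoiding_paths ends N F & {subset val c <= s}.
Proof.
move=> /loop_erasure[s' [h1 h2 h3]].
(* A path with distinct vertices visits one vertex more than it has edges, so it fits in the bounded
   sequences used by [self_avoiding_paths]. *)
have sz : (size s' <= #|V|)%N.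
  by apply: ltnW; rewrite -(size_visited N) -(card_uniqP h2) max_card.
by exists (Bseq sz) => //; rewrite inE /= h1.
Qed.

Lemma path_first_edge N F s : N != F -> path_between ends N F s ->
  exists2 e, e \in s & incident ends e N.
Proof.
move=> NF; case: s => [|e s]; first by rewrite /path_between /= (negPf NF).
by rewrite /path_between /= => /andP[/andP[ie _] _]; exists e; rewrite ?mem_head.
Qed.

End LoopErasure.

(** * The weighted Laplacian killed on a set of edges *)

Section Laplacian.
Context {V : finType} {d : nat} {R : realType}.
Variables (ends : 'I_d -> V * V).
Implicit Types (w : 'rV[R]_d) (D : pred 'I_d) (f g v : V -> R).

(** Edges of [D] lead to a cemetery where [v] vanishes, but they still count in the total weight at
    [x]. *)
Definition killed_laplacian w D v x :=
  \sum_(e | incident ends e x)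
     w ord0 e * (v x - (if D e then 0 else v (cross ends x e))).

Definition killed_average w D v x :=
  \sum_(e | incident ends e x && ~~ D e)
     w ord0 e / vertex_weight ends w x * v (cross ends x e).

Lemma sum_incident (e : 'I_d) (G : V -> R) : (\sum_(x | incident ends e x) G x =
  G (ends e).1 + (if (ends e).1 == (ends e).2 then 0 else G (ends e).2))%R.
Proof.
rewrite (bigD1 (ends e).1) ?/incident ?eqxx//=; congr (_ + _).
case: eqP => [ab|/eqP ab].
  rewrite big_pred0// => x; rewrite -ab.
  by case: (_ == _).
rewrite (big_pred1 (ends e).2)// => x /=.
have [->|_] := eqVneq x (ends e).1; first by rewrite (negPf ab) andbF.
by rewrite andbT.
Qed.

(** Regrouped by edges with endpoints a, b, both sides are sums of symmetric bilinear forms: w_e (f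
    a - f b)(g a - g b) off [D], and w_e (f a g a + f b g b) on [D]. A self-loop, which [incident]
    counts once, is treated apart. *)
Lemma killed_laplacian_sym w D f g :
  \sum_x g x * killed_laplacian w D f x = \sum_x f x * killed_laplacian w D g x.
Proof.
have E (h k : V -> R) : \sum_x h x * killed_laplacian w D k x =
    \sum_e \sum_(x | incident ends e x)
       w ord0 e * (h x * (k x - (if D e then 0 else k (cross ends x e)))).
  rewrite (exchange_big_dep predT)//=; apply: eq_bigr => x _.
  by rewrite /killed_laplacian big_distrr/=; apply: eq_bigr => e _; rewrite mulrCA.
rewrite !E; apply: eq_bigr => e _; rewrite !sum_incident /cross eqxx.
have [->|ab] := eqVneq (ends e).1 (ends e).2.
  by case: (D e); ring.
by case: (D e); ring.
Qed.

Lemma killed_laplacian_energy w f : \sum_x f x * killed_laplacian w pred0 f x =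
  \sum_e w ord0 e * (f (ends e).1 - f (ends e).2) ^+ 2.
Proof.
under eq_bigr do rewrite /killed_laplacian big_distrr/=.
rewrite (exchange_big_dep predT)//=; apply: eq_bigr => e _.
rewrite sum_incident /cross eqxx.
have [->|ab] := eqVneq (ends e).1 (ends e).2.
  by ring.
by ring.
Qed.

Lemma vertex_weight_ge0 w x :
  (forall e, 0 <= w ord0 e) -> 0 <= vertex_weight ends w x.
Proof. by move=> w0; apply: sumr_ge0. Qed.

Lemma weight_le_vertex w x e : (forall e, 0 <= w ord0 e) ->
  incident ends e x -> w ord0 e <= vertex_weight ends w x.
Proof.
move=> w0 ie; rewrite /vertex_weight (bigD1 e)//= lerDl.
by apply: sumr_ge0.
Qed.

(** The averaging weights have total mass at most 1: mass is lost on [D], and all of it when the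
    vertex weight is 0. *)
Lemma killed_average_const w D (c : R) x : (forall e, 0 <= w ord0 e) -> 0 <= c ->
  killed_average w D (fun=> c) x <= c.
Proof.
move=> w0 c0; rewrite /killed_average -mulr_suml -mulr_suml.
apply: ler_piMl => //.
have [pi0|pi0] := eqVneq (vertex_weight ends w x) 0.
  by rewrite pi0 invr0 mulr0.
have pi1 : 0 < vertex_weight ends w x.
  by rewrite lt_neqAle eq_sym pi0 vertex_weight_ge0.
rewrite ler_pdivrMr// mul1r /vertex_weight [leRHS](bigID D)/= lerDr.
by apply: sumr_ge0.
Qed.

Lemma killed_average_le w D v v' x : (forall e, 0 <= w ord0 e) ->
  (forall y, v y <= v' y) -> killed_average w D v x <= killed_average w D v' x.
Proof.
move=> w0 vv; apply: ler_sum => e _; apply: ler_wpM2l => //.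
by rewrite divr_ge0// vertex_weight_ge0.
Qed.

Lemma killed_average_ge0 w D v x : (forall e, 0 <= w ord0 e) ->
  (forall y, 0 <= v y) -> 0 <= killed_average w D v x.
Proof.
by move=> w0 v0; apply: sumr_ge0 => e _; rewrite mulr_ge0// divr_ge0 ?vertex_weight_ge0.
Qed.

(* If [vertex_weight ends w x = 0] then [killed_average] is the junk value 0,
   but every weight at x vanishes and both sides are 0. *)
Lemma killed_laplacian_average w D v x b : (forall e, 0 <= w ord0 e) ->
  v x = b + killed_average w D v x ->
  killed_laplacian w D v x = vertex_weight ends w x * b.
Proof.
move=> w0 vx.
have [pi0|pi0] := eqVneq (vertex_weight ends w x) 0.
  rewrite pi0 mul0r /killed_laplacian big1// => e ie.
  suff -> : w ord0 e = 0 by rewrite mul0r.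
  by apply/eqP; rewrite eq_le w0 -pi0 weight_le_vertex.
have -> : killed_laplacian w D v x =
    vertex_weight ends w x * (v x - killed_average w D v x).
  rewrite mulrBr /killed_laplacian /vertex_weight mulr_suml -/(vertex_weight _ _ _).
  rewrite /killed_average mulr_sumr [X in _ = _ - X]big_mkcondr/= -sumrB.
  apply: eq_bigr => e _; rewrite mulrBr; congr (_ - _).
  case: (D e) => /=; first by rewrite mulr0.
  by rewrite mulrA [_ * (w _ _ / _)]mulrC divfK.
by rewrite {1}vx addrK.
Qed.

Lemma killed_average_cvg w D (v : nat -> V -> R) (l : V -> R) x :
  (forall y, v ^~ y @ \oo --> l y) ->
  (fun k => killed_average w D (v k) x) @ \oo --> killed_average w D l x.
Proof.
move=> vl; rewrite /killed_average.
apply: cvg_big => [|e _]; first exact: add_continuous.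
by apply: cvgMl_tmp; exact: vl.
Qed.

Lemma killed_average_fixpoint w D (v : nat -> V -> R) (l : V -> R) x b :
  (forall y, v ^~ y @ \oo --> l y) ->
  (forall k, v k.+1 x = b + killed_average w D (v k) x) ->
  l x = b + killed_average w D l x.
Proof.
move=> vl vS.
have h1 : (fun k => v k.+1 x) @ \oo --> l x.
  by rewrite (cvg_shiftS (v ^~ x)); exact: vl.
have h2 : (fun k => v k.+1 x) @ \oo --> b + killed_average w D l x.
  under eq_cvg => k do rewrite vS.
  by apply: cvgD; [exact: cvg_cst|exact: killed_average_cvg].
exact: (cvg_unique _ h1 h2).
Qed.

End Laplacian.

(** * The Green function with pole N and its uniform bound *)

Section Green.
Context {V : finType} {d : nat} {R : realType}.
Variables (ends : 'I_d -> V * V) (N F : V).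
Variables (w : 'rV[R]_d) (D : pred 'I_d).
Hypothesis w01 : forall e, 0 <= w ord0 e <= 1.
Hypothesis wN : 1 <= vertex_weight ends w N.

Let weight_ge0 e : 0 <= w ord0 e. Proof. by have /andP[] := w01 e. Qed.

Let vertex_weightN_gt0 : 0 < vertex_weight ends w N.
Proof. exact: lt_le_trans wN. Qed.

(** The normalisation turns the source into exactly the indicator of N once
    [killed_laplacian_average] multiplies by the vertex weight. *)
Definition green_source x : R := (x == N)%:R / vertex_weight ends w N.
Local Notation b := green_source.

Lemma green_source_ge0 x : 0 <= b x.
Proof. by rewrite /green_source divr_ge0// ltW. Qed.

Lemma green_source_le1 x : b x <= 1.
Proof.
by rewrite /green_source ler_pdivrMr// mul1r (le_trans _ wN)// lern1 leq_b1.
Qed.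

(** Truncated Green function: the expected number of visits to N at times less than [k], for the
    walk started at [x] and killed at F and on [D], divided by the vertex weight of N. *)
Fixpoint green_iter k x : R :=
  if k is k'.+1 then
    if x == F then 0 else b x + killed_average ends w D (green_iter k') x
  else 0.
Local Notation u := green_iter.

Lemma green_iterS k x : x != F ->
  u k.+1 x = b x + killed_average ends w D (u k) x.
Proof. by move=> /negPf /= ->. Qed.

Lemma green_iterF k : u k F = 0. Proof. by case: k => //= k; rewrite eqxx. Qed.

Lemma green_iter_ge0 k x : 0 <= u k x.
Proof.
elim: k x => //= k IH x; case: ifP => // _.
by rewrite addr_ge0 ?green_source_ge0// killed_average_ge0.
Qed.

#[local] Hint Resolve green_iter_ge0 : core.

Lemma green_iter_nondecreasing k x : u k x <= u k.+1 x.
Proof.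
elim: k x => [x|k IH x]; first exact: (green_iter_ge0 1).
have [->|xF] := eqVneq x F; first by rewrite !green_iterF.
by rewrite !green_iterS// lerD2l killed_average_le.
Qed.

(** Maximum principle: away from N and F the new iterate is an average of the previous one, of total
    mass at most 1, and the iterates increase with [k]. *)
Lemma green_iter_max k x : u k x <= u k N.
Proof.
elim: k x => // k IH x.
have [->|xF] := eqVneq x F; first by rewrite green_iterF green_iter_ge0.
have [->//|xN] := eqVneq x N.
rewrite green_iterS// /b (negPf xN) mul0r add0r;
apply: (le_trans _ (green_iter_nondecreasing k N)).
apply: (@le_trans _ _ (killed_average ends w D (fun=> u k N) x)).
  exact: killed_average_le.
exact: killed_average_const.
Qed.

Lemma size_ge1 (e : 'I_d) : 1 <= d%:R :> R.
Proof. by rewrite ler1n (leq_ltn_trans _ (ltn_ord e)). Qed.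

Lemma vertex_weight_le_size x : vertex_weight ends w x <= d%:R.
Proof.
apply: (@le_trans _ _ (\sum_(e < d) 1)); last by rewrite sumr_const card_ord.
rewrite /vertex_weight big_mkcond/=; apply: ler_sum => e _.
by case: ifP => // _; have /andP[] := w01 e.
Qed.

(** The maximum principle bounds the contribution of every other edge by [u k N], while [e] improves
    this to [m]. If [e] is in [D], its contribution is 0 and [0 <= m] suffices. *)
Lemma killed_average_edge k x e m : incident ends e x -> 0 < w ord0 e ->
  u k (cross ends x e) <= m -> 0 <= m ->
  killed_average ends w D (u k) x <=
  u k N + w ord0 e / vertex_weight ends w x * (m - u k N).
Proof.
move=> ie we um m0.
have pix : 0 < vertex_weight ends w x.
  exact: lt_le_trans (weight_le_vertex weight_ge0 ie).
apply: (@le_trans _ _ (\sum_(e' | incident ends e' x)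
  w ord0 e' / vertex_weight ends w x * (if e' == e then m else u k N))).
  rewrite /killed_average big_mkcondr/=; apply: ler_sum => e' _.
  have p0 : 0 <= w ord0 e' / vertex_weight ends w x by rewrite divr_ge0// ltW.
  case: ifP => _; last by rewrite mulr_ge0//; case: ifP.
  apply: ler_wpM2l => //; case: eqP => [->//|_]; exact: green_iter_max.
have -> : u k N = \sum_(e' | incident ends e' x)
    w ord0 e' / vertex_weight ends w x * u k N.
  by rewrite -!mulr_suml -/(vertex_weight ends w x) divff ?mul1r// gt_eqF.
rewrite (bigD1 e)//= [X in _ <= X + _](bigD1 e)//= eqxx.
rewrite -!mulr_suml -/(vertex_weight ends w x) divff ?gt_eqF// mul1r.
rewrite le_eqVlt; apply/orP; left; apply/eqP.
under eq_bigr => e' /andP[_ /negPf ->] do [].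
by rewrite -!mulr_suml; ring.
Qed.

(** Each edge of [c] is followed with probability at least [eps / d], so the walk escapes along [c]
    with probability at least the power of this; otherwise it is charged [u k N]. Each step on the
    way adds at most 1 through the source. *)
Lemma green_iter_path (eps : R) c k x : 0 < eps -> path_between ends x F c ->
  (forall e, e \in c -> eps <= w ord0 e) ->
  u k x <= (size c)%:R + (1 - (eps / d%:R) ^+ size c) * u k N.
Proof.
move=> eps0; elim: c x => [|e c IH] x.
  rewrite /path_between /= => /eqP-> _.
  by rewrite expr0 subrr mul0r green_iterF addr0.
rewrite /path_between /= => /andP[/andP[ie pc] fc] ew.
have we : eps <= w ord0 e by apply: ew; rewrite mem_head.
have d1 := size_ge1 e; have d0 : 0 < d%:R :> R by exact: lt_le_trans d1.
have /andP[_ we1] := w01 e.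
have de0 : 0 < eps / d%:R by rewrite divr_gt0.
have de1 : eps / d%:R <= 1.
  by rewrite ler_pdivrMr// mul1r (le_trans we)// (le_trans we1).
have dn0 n : 0 < (eps / d%:R) ^+ n by rewrite exprn_gt0.
have dn1 n : (eps / d%:R) ^+ n <= 1 by rewrite exprn_ile1// ltW.
have U0 := green_iter_ge0 k N.
have pc' : path_between ends (cross ends x e) F c by rewrite /path_between pc.
have {IH} := IH _ pc' (fun e' h => ew e' (@mem_behead _ (e :: c) e' h)).
set m : R := (_ + _) => um.
have m0 : 0 <= m by rewrite /m addr_ge0// mulr_ge0// subr_ge0.
have [->|xF] := eqVneq x F.
  by rewrite green_iterF addr_ge0// mulr_ge0// subr_ge0 dn1.
have pix : 0 < vertex_weight ends w x.
  by apply: lt_le_trans (weight_le_vertex weight_ge0 ie); exact: lt_le_trans we.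
have H := killed_average_edge ie (lt_le_trans eps0 we) um m0.
(* Passing to [k.+1] before unfolding keeps the same index [k] on both sides, so that the inequality
   at N closes on [u k N]. *)
apply: (le_trans (green_iter_nondecreasing k x)); rewrite green_iterS//.
set p := w ord0 e / _ in H.
(* At most [d] edges of weight at most 1 meet at [x]. *)
have p_ge : eps / d%:R <= p.
  rewrite /p ler_pM//; first exact: ltW.
  by rewrite lef_pV2 ?posrE ?vertex_weight_le_size.
have p1 : p <= 1 by rewrite /p ler_pdivrMr// mul1r weight_le_vertex.
have := green_source_le1 x; rewrite exprS -natr1; set q := (_ / _) ^+ _.
have q0 : 0 < q := dn0 _.
have h1 : p * (size c)%:R <= (size c)%:R.
  by rewrite -[leRHS]mul1r ler_wpM2r.
have h2 : eps / d%:R * (q * u k N) <= p * (q * u k N).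
  by rewrite ler_wpM2r// mulr_ge0// ltW.
move: H; rewrite /m -/q; move: h1 h2; rewrite !mulrA.
have -> : p * ((size c)%:R + (1 - q) * u k N - u k N) =
   p * (size c)%:R - p * q * u k N by ring.
rewrite !mulrBl mul1r; lra.
Qed.

(** The value obtained by solving [green_iter_path] at N for [u k N], for a path of length at most
    [n]. *)
Definition green_bound (n : nat) (eps : R) : R := n%:R / (eps / d%:R) ^+ n.

(** The iterates are nondecreasing and bounded, and their limit solves the fixed-point equation. The
    bound depends on [w] only through [eps], which is what makes the Lipschitz constant uniform. *)
Lemma green_function (eps : R) c : 0 < eps -> (size c <= #|V|)%N ->
  path_between ends N F c -> (forall e, e \in c -> eps <= w ord0 e) ->
  N != F ->
  exists g : V -> R, [/\ g F = 0, forall x, 0 <= g x <= green_bound #|V| eps &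
    forall x, x != F -> killed_laplacian ends w D g x = (x == N)%:R].
Proof.
move=> eps0 sc pc ec NF.
have uM k x : u k x <= green_bound #|V| eps.
  apply: (le_trans (green_iter_max k x)).
  have := green_iter_path k eps0 pc ec; set U := u k N.
  have [e ie] : exists e, e \in c by have [e] := path_first_edge NF pc; exists e.
  have d1 := size_ge1 e; have d0 : 0 < d%:R :> R by exact: lt_le_trans d1.
  have /andP[_ we1] := w01 e.
  have de0 : 0 < eps / d%:R by rewrite divr_gt0.
  have de1 : eps / d%:R <= 1.
    by rewrite ler_pdivrMr// mul1r (le_trans (ec _ ie))// (le_trans we1).
  rewrite mulrBl mul1r addrCA lerDl subr_ge0 => h.
  rewrite /green_bound ler_pdivlMr ?exprn_gt0// mulrC.
  apply: (@le_trans _ _ ((eps / d%:R) ^+ size c * U)).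
    by rewrite ler_wpM2r ?green_iter_ge0// ler_wiXn2l// ltW.
  by rewrite (le_trans h)// ler_nat.
have cv x : cvgn (u ^~ x).
  apply: nondecreasing_is_cvgn.
    by apply/nondecreasing_seqP => n; exact: green_iter_nondecreasing.
  by exists (green_bound #|V| eps) => _ [n _ <-]; exact: uM.
have cvl x : u ^~ x @ \oo --> limn (u ^~ x) by exact: cv.
exists (fun x => limn (u ^~ x)); split.
- by under eq_fun do rewrite green_iterF; rewrite lim_cst.
- move=> x; apply/andP; split.
    by apply: limr_ge => //; apply: nearW => n; exact: green_iter_ge0.
  by apply: limr_le => //; apply: nearW => n; exact: uM.
- move=> x xF.
  rewrite (@killed_laplacian_average _ _ _ _ _ _ _ _ (b x))//.
    rewrite /green_source; have [->|_] := eqVneq x N; last by rewrite mul0r mulr0.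
    by rewrite mul1r divff// gt_eqF.
  by apply: (killed_average_fixpoint cvl) => k; exact: green_iterS.
Qed.

End Green.

(** * Avoidance probabilities and Lipschitz dependence on the weights *)

Section Avoidance.
Context {V : finType} {d : nat} {R : realType}.
Variables (ends : 'I_d -> V * V) (F : V).
Implicit Types (w : 'rV[R]_d) (A : pred (option 'I_d)).

(** One definition for three uses: [predC1 (Some e)] gives avoidance of [e], [predC1 None] gives
    survival, and [predT] gives the total mass. *)
Definition avoid_prob A w k x : R :=
  \sum_(s : k.-tuple (option 'I_d) | all A s) traj_prob ends F w x s.

Definition avoid_lim A w x : R := limn (avoid_prob A w ^~ x).

Lemma sum_option (A : pred (option 'I_d)) (G : option 'I_d -> R) :
  \sum_(o | A o) G o =
  (if A None then G None else 0) + \sum_(e | A (Some e)) G (Some e).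
Proof.
rewrite big_mkcond (bigD1 None)//= (reindex_omap Some id) => [|[]]//=.
by congr (_ + _); rewrite [RHS]big_mkcond; apply: eq_bigl => e; rewrite eqxx.
Qed.

Lemma avoid_probS A w k x : avoid_prob A w k.+1 x =
  \sum_(o | A o) step_prob ends F w x o * avoid_prob A w k (next_vertex ends x o).
Proof.
rewrite /avoid_prob; under [RHS]eq_bigr do rewrite big_distrr/=.
rewrite pair_big_dep/= (reindex (fun p : _ * k.-tuple _ => [tuple of p.1 :: p.2]))//=.
exists (fun s => (thead s, [tuple of behead s])); last first.
  by move=> s _; rewrite /= -tuple_eta.
by case=> o s _; rewrite theadE; congr pair; apply: val_inj.
Qed.

Lemma avoid_prob0 A w x : avoid_prob A w 0 x = 1.
Proof.
rewrite /avoid_prob (big_pred1 [tuple])//= => s.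
by rewrite tuple0; apply/esym/eqP.
Qed.

Lemma avoid_prob_F A w k :
  avoid_prob A w k.+1 F = if A None then avoid_prob A w k F else 0.
Proof.
rewrite avoid_probS sum_option/= eqxx mul1r big1 ?addr0//.
by move=> e _; rewrite mul0r.
Qed.

Lemma avoid_prob_step A w k x : x != F -> avoid_prob A w k.+1 x =
  killed_average ends w (fun e => ~~ A (Some e)) (avoid_prob A w k) x.
Proof.
move=> xF; rewrite avoid_probS sum_option/= (negPf xF) mul0r if_same add0r.
rewrite /killed_average big_mkcond [RHS]big_mkcond; apply: eq_bigr => e _.
by rewrite negbK/=; case: (A _); case: incident; rewrite ?mul0r.
Qed.

Section NonnegativeWeights.
Variables (w : 'rV[R]_d) (A : pred (option 'I_d)).
Hypothesis w0 : forall e, 0 <= w ord0 e.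

Lemma avoid_prob_ge0 k x : 0 <= avoid_prob A w k x.
Proof.
elim: k x => [x|k IH x]; first by rewrite avoid_prob0.
have [->|xF] := eqVneq x F; first by rewrite avoid_prob_F; case: ifP.
by rewrite avoid_prob_step// killed_average_ge0.
Qed.

Lemma avoid_prob_nonincreasing k x : avoid_prob A w k.+1 x <= avoid_prob A w k x.
Proof.
elim: k x => [x|k IH x].
  have [->|xF] := eqVneq x F.
    by rewrite avoid_prob_F !avoid_prob0; case: ifP.
  have E : avoid_prob A w 0 = fun=> 1 by apply/funext => y; exact: avoid_prob0.
  rewrite avoid_prob_step// E.
  exact: killed_average_const.
have [->|xF] := eqVneq x F; last by rewrite !avoid_prob_step// killed_average_le.
by rewrite [leRHS]avoid_prob_F avoid_prob_F; case: ifP.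
Qed.

Lemma avoid_prob_le1 k x : avoid_prob A w k x <= 1.
Proof.
elim: k => [|k IH]; first by rewrite avoid_prob0.
exact: le_trans (avoid_prob_nonincreasing k x) IH.
Qed.

Lemma avoid_prob_cvg x : avoid_prob A w ^~ x @ \oo --> avoid_lim A w x.
Proof.
have : cvgn (avoid_prob A w ^~ x) by [|
  apply: nonincreasing_is_cvgn; [apply/nonincreasing_seqP => k;
    exact: avoid_prob_nonincreasing
  | by exists 0 => _ [k _ <-]; exact: avoid_prob_ge0]].
exact.
Qed.

Lemma avoid_prob_lim01 x : 0 <= avoid_lim A w x <= 1.
Proof.
apply/andP; split.
  apply: limr_ge; [exact: avoid_prob_cvg|].
  by apply: nearW => n; exact: avoid_prob_ge0.
apply: limr_le; [exact: avoid_prob_cvg|].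
by apply: nearW => n; exact: avoid_prob_le1.
Qed.

Lemma avoid_prob_lim_F : avoid_lim A w F = (A None)%:R.
Proof.
(* At [k = 0] the probability is 1 even if [A] rejects [None], so the sequence is constant only
   after a shift by one. *)
apply/cvg_lim => //; rewrite -(cvg_shiftS (avoid_prob A w ^~ F)).
have -> : (fun n => avoid_prob A w n.+1 F) = cst (A None)%:R.
  apply/funext => n; rewrite /cst; have := avoid_prob_F A w.
  case: (A None) => /= E; last by rewrite E.
  by elim: n => [|n IH]; rewrite E ?avoid_prob0.
exact: cvg_cst.
Qed.

Lemma avoid_prob_harmonic x : x != F ->
  killed_laplacian ends w (fun e => ~~ A (Some e))
    (avoid_lim A w) x = 0.
Proof.
move=> xF; rewrite (@killed_laplacian_average _ _ _ _ _ _ _ _ 0) ?mulr0//.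
apply: (killed_average_fixpoint avoid_prob_cvg) => k.
by rewrite add0r avoid_prob_step.
Qed.

End NonnegativeWeights.

(** Mass could be lost only at a vertex of weight 0 other than F. Such a vertex is never entered,
    since the edge just crossed has positive weight and is incident to its new endpoint. *)
Lemma avoid_prob_predT w k x : (forall e, 0 <= w ord0 e) ->
  (x == F) || (0 < vertex_weight ends w x) -> avoid_prob predT w k x = 1.
Proof.
move=> w0; elim: k x => [x _|k IH x]; first exact: avoid_prob0.
have [-> _|xF /= pix] := eqVneq x F; first by rewrite avoid_prob_F/= IH ?eqxx.
rewrite avoid_prob_step// /killed_average.
rewrite (eq_bigr (fun e => w ord0 e / vertex_weight ends w x)).
  rewrite -mulr_suml; under eq_bigl do rewrite /= andbT.
  by rewrite divff// gt_eqF.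
move=> e /andP[ie _].
have [we0|we0] := eqVneq (w ord0 e) 0; first by rewrite we0 !mul0r.
rewrite IH ?mulr1//; apply/orP; right.
apply: (@lt_le_trans _ _ (w ord0 e)); first by rewrite lt_neqAle eq_sym we0 w0.
exact: weight_le_vertex (incident_cross ie).
Qed.

Lemma trace_prob_avoid w N e : (forall e, 0 <= w ord0 e) ->
  0 < vertex_weight ends w N ->
  trace_prob ends N F w e = 1 - avoid_lim (predC1 (Some e)) w N.
Proof.
move=> w0 piN; rewrite /trace_prob; apply/cvg_lim => //.
rewrite (_ : (fun _ => _) = (fun k => 1 - avoid_prob (predC1 (Some e)) w k N)).
  by apply: cvgB; [exact: cvg_cst|exact: avoid_prob_cvg].
apply/funext => k; rewrite -(@avoid_prob_predT w k N) ?piN ?orbT//.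
apply/eqP; rewrite eq_sym subr_eq; apply/eqP.
rewrite [LHS](bigID (fun s : k.-tuple _ => Some e \in val s))/=.
congr (_ + _); apply: eq_bigl => s; rewrite all_predT//=.
by rewrite all_predC has_pred1.
Qed.

Lemma killed_laplacian_sub w w' D f x :
  killed_laplacian ends w D f x - killed_laplacian ends w' D f x =
  killed_laplacian ends (w - w') D f x.
Proof.
rewrite /killed_laplacian -sumrB; apply: eq_bigr => e _.
by rewrite !mxE mulrBl.
Qed.

(* Resolvent identity: with [m], [m'] the avoidance probabilities of [w], [w']
   and [g] the Green function of [w], symmetry of the Laplacian gives
   m N - m' N = \sum_x g x * L_w (m - m') x = - \sum_x g x * (L_w - L_w') m' x. *)
Lemma trace_prob_lipschitz (N : V) w w' e (eps : R) c : N != F ->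
  (forall e, 0 <= w ord0 e <= 1) -> (forall e, 0 <= w' ord0 e <= 1) ->
  1 <= vertex_weight ends w N -> 1 <= vertex_weight ends w' N ->
  0 < eps -> (size c <= #|V|)%N -> path_between ends N F c ->
  (forall e, e \in c -> eps <= w ord0 e) ->
  `|trace_prob ends N F w e - trace_prob ends N F w' e| <=
    @green_bound d R #|V| eps * (#|V| * d)%:R * `|w - w'|.
Proof.
move=> NF w01 w01' wN wN' eps0 sc pc ec.
have w0 e' : 0 <= w ord0 e' by have /andP[] := w01 e'.
have w0' e' : 0 <= w' ord0 e' by have /andP[] := w01' e'.
pose D : pred 'I_d := fun e' => ~~ predC1 (Some e) (Some e').
have [g [gF gM gL]] := green_function D w01 wN eps0 sc pc ec NF.
rewrite !trace_prob_avoid//; [|exact: lt_le_trans wN'|exact: lt_le_trans wN].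
pose m := avoid_lim (predC1 (Some e)).
have -> : 1 - avoid_lim (predC1 (Some e)) w N -
    (1 - avoid_lim (predC1 (Some e)) w' N) = - (m w N - m w' N).
  by rewrite /m; ring.
rewrite normrN.
pose f x := m w x - m w' x.
have fF : f F = 0 by rewrite /f /m !avoid_prob_lim_F subrr.
have fL x : x != F -> killed_laplacian ends w D f x =
    - killed_laplacian ends (w - w') D (m w') x.
  move=> xF; rewrite -killed_laplacian_sub (avoid_prob_harmonic _ w0' xF) subr0.
  rewrite -[RHS]add0r -(avoid_prob_harmonic (predC1 (Some e)) w0 xF).
  rewrite -sumrB; apply: eq_bigr => e' _; rewrite -/(m _) /f /D.
  by case: (~~ _); ring.
have fN : m w N - m w' N = - \sum_(x | x != F)
    g x * killed_laplacian ends (w - w') D (m w') x.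
  (* At F neither [gL] nor [fL] applies; [fF] removes that term on one side and [gF] on the
     other. *)
  transitivity (\sum_x f x * killed_laplacian ends w D g x).
    rewrite (bigD1 N)//= gL// eqxx mulr1 -/(f N) big1 ?addr0// => x xN.
    have [->|xF] := eqVneq x F; first by rewrite fF mul0r.
    by rewrite gL// (negPf xN) mulr0.
  rewrite -killed_laplacian_sym (bigD1 F)//= gF mul0r add0r -sumrN.
  by apply: eq_bigr => x xF; rewrite fL// mulrN.
rewrite fN normrN.
have m01 x : 0 <= m w' x <= 1 := avoid_prob_lim01 _ w0' x.
have M0 : 0 <= @green_bound d R #|V| eps by have /andP[h] := gM F; exact: le_trans.
apply: (@le_trans _ _ (\sum_x \sum_(e' < d) @green_bound d R #|V| eps * `|w - w'|)).
  rewrite (le_trans (ler_norm_sum _ _ _))// big_mkcond/=; apply: ler_sum => x _.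
  case: ifP => _; last by apply: sumr_ge0 => e' _; rewrite mulr_ge0.
  have /andP[g0 g1] := gM x.
  rewrite normrM ger0_norm// -mulr_sumr ler_pM//.
  rewrite (le_trans (ler_norm_sum _ _ _))// big_mkcond/=; apply: ler_sum => e' _.
  case: ifP => _ //; rewrite normrM -[leRHS]mulr1 ler_pM//.
    rewrite [leRHS]/Num.norm/= mx_normrE (le_trans _ (le_bigmax _ _ (ord0, e')))//.
  (* A difference of two values in [0,1], or a single such value if [e'] is killed, has absolute
     value at most 1. *)
  have := m01 x; have := m01 (cross ends x e').
  by rewrite ler_norml; case: (D e'); lra.
by rewrite !sumr_const card_ord -mulrnA mulnC -[leLHS]mulr_natr mulrAC.
Qed.

End Avoidance.

(** * Joins of convex sets *)

Section Hull.
Context {R : realType} {d : nat}.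
Implicit Types (A B : set 'rV[R]_d).

Lemma convex_setP A : @convex_set R 'rV[R]_d A <->
  forall x y (t : R), A x -> A y -> 0 <= t <= 1 -> A (t *: x + (1 - t) *: y).
Proof.
split=> [cA x y t Ax Ay /andP[t0 t1]|cA x y t].
  by have := cA x y (Itv01 t0 t1); rewrite !inE; apply.
rewrite !inE => Ax Ay; apply: cA => //.
by rewrite ge0 le1.
Qed.

Lemma convex_combination A x y (p q : R) : @convex_set R 'rV[R]_d A ->
  A x -> A y -> 0 <= p -> 0 <= q ->
  exists2 z, A z & p *: x + q *: y = (p + q) *: z.
Proof.
move=> /convex_setP cA Ax Ay p0 q0.
have [pq0|pq0] := eqVneq (p + q) 0.
  exists x => //; have : p = 0 /\ q = 0 by lra.
  by case=> -> ->; rewrite addr0 !scale0r addr0.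
have pq : 0 < p + q by rewrite lt_neqAle eq_sym pq0 addr_ge0.
exists (p / (p + q) *: x + (1 - p / (p + q)) *: y).
  apply: cA => //; apply/andP; split; first by rewrite divr_ge0// ltW.
  by rewrite ler_pdivrMr// mul1r lerDl.
by rewrite scalerDr !scalerA; congr (_ *: _ + _ *: _); field.
Qed.

(** For nonempty convex [A] and [B] this is the convex hull of their union, in a parametrised form
    from which compactness can be read off. *)
Definition mix A B : set 'rV[R]_d :=
  [set w | exists t a b,
     [/\ 0 <= t <= 1, A a, B b & w = t *: a + (1 - t) *: b]].

(** The four terms are regrouped into those from [A] and those from [B], and each pair is
    renormalised by [convex_combination]. *)
Lemma mix_convex A B : @convex_set R 'rV[R]_d A -> @convex_set R 'rV[R]_d B ->
  @convex_set R 'rV[R]_d (mix A B).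
Proof.
move=> cA cB; apply/convex_setP => _ _ s [t [a [b [t01 Aa Bb ->]]]]
  [t' [a' [b' [t01' Aa' Bb' ->]]]] s01.
have [||a2 Aa2 aE] := convex_combination (p := s * t) (q := (1 - s) * t') cA Aa Aa'.
- by rewrite mulr_ge0//; lra.
- by rewrite mulr_ge0//; lra.
have [||b2 Bb2 bE] := convex_combination (p := s * (1 - t))
    (q := (1 - s) * (1 - t')) cB Bb Bb'.
- by rewrite mulr_ge0//; lra.
- by rewrite mulr_ge0//; lra.
exists (s * t + (1 - s) * t'), a2, b2; split=> //.
  by apply/andP; split; nra.
rewrite -aE !scalerDr !scalerA addrACA; congr (_ + _).
by rewrite bE; congr (_ *: _); ring.
Qed.

(** [mix A B] is a continuous image of [0,1] × A × B. *)
Lemma mix_compact A B : compact A -> compact B -> compact (mix A B).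
Proof.
move=> kA kB.
pose f (p : R * ('rV[R]_d * 'rV[R]_d)) := p.1 *: p.2.1 + (1 - p.1) *: p.2.2.
have -> : mix A B = f @` (`[0, 1]%classic `*` (A `*` B)).
  apply/seteqP; split=> [w [t [a [b [t01 Aa Bb ->]]]]|].
    by exists (t, (a, b)) => //; split=> //=; rewrite in_itv.
  move=> _ [[t [a b]] /= [t01 [Aa Bb]] <-]; exists t, a, b; split=> //.
apply: continuous_compact.
  apply: continuous_subspaceT => p.
  have c1 : {for p, continuous (fun q : R * ('rV[R]_d * 'rV[R]_d) => q.1)}.
    exact: cvg_fst.
  have c2 : {for p, continuous (fun q : R * ('rV[R]_d * 'rV[R]_d) => q.2)}.
    exact: cvg_snd.
  apply: cvgD; apply: cvgZ.
  - exact: c1.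
  - by apply: cvg_comp c2 _; exact: cvg_fst.
  - by apply: cvgB; [exact: cvg_cst|exact: c1].
  - by apply: cvg_comp c2 _; exact: cvg_snd.
apply: compact_setX; first exact: segment_compact.
exact: compact_setX.
Qed.

Lemma sub_mixl A B : B !=set0 -> A `<=` mix A B.
Proof.
move=> [b Bb] a Aa; exists 1, a, b; split=> //; first by rewrite ler01 lexx.
by rewrite subrr scale0r addr0 scale1r.
Qed.

Lemma sub_mixr A B : A !=set0 -> B `<=` mix A B.
Proof.
move=> [a Aa] b Bb; exists 0, a, b; split=> //; first by rewrite ler01 lexx.
by rewrite subr0 scale0r add0r scale1r.
Qed.

Lemma mix_sub A B C : @convex_set R 'rV[R]_d C -> A `<=` C -> B `<=` C ->
  mix A B `<=` C.
Proof.
move=> /convex_setP cC AC BC _ [t [a [b [t01 Aa Bb ->]]]].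
by apply: cC => //; [exact: AC|exact: BC].
Qed.

Lemma convex_hull_convex A : @convex_set R 'rV[R]_d (convex_hull A).
Proof.
apply/convex_setP => x y t Ax Ay t01 C [/= cC AC].
by move/convex_setP : (cC); apply=> //; [exact: Ax|exact: Ay].
Qed.

End Hull.

(** * The hull: compactness and a uniformly weighted path *)

Section EHull.
Context {R : realType} {V : finType} {d : nat}.
Variables (ends : 'I_d -> V * V) (N F : V).

Local Notation S := (#|self_avoiding_paths ends N F|).
Local Notation Ep := (@E_path V d ends N F R).

Lemma vertex_weight_continuous x :
  continuous (fun w : 'rV[R]_d => vertex_weight ends w x).
Proof.
move=> w; rewrite /vertex_weight.
apply: cvg_big => [||e _]; first exact: add_continuous.
  exact: nbhs_filter.
exact: coord_continuous.
Qed.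

Lemma vertex_weightD (w w' : 'rV[R]_d) x : vertex_weight ends (w + w') x =
  vertex_weight ends w x + vertex_weight ends w' x.
Proof. by rewrite -big_split; apply: eq_bigr => e _; rewrite mxE. Qed.

Lemma vertex_weightZ a (w : 'rV[R]_d) x :
  vertex_weight ends (a *: w) x = a * vertex_weight ends w x.
Proof. by rewrite mulr_sumr; apply: eq_bigr => e _; rewrite mxE. Qed.

Lemma E_path_convex c : @convex_set R 'rV[R]_d (Ep c).
Proof.
apply/convex_setP => x y t [x01 xN xc] [y01 yN yc] /andP[t0 t1].
have t1' : 0 <= 1 - t by rewrite subr_ge0.
split=> [e||e ec]; rewrite ?vertex_weightD ?vertex_weightZ ?mxE.
- by have := x01 e; have := y01 e; move=> /andP[? ?] /andP[? ?]; apply/andP; nra.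
- by nra.
- by have := xc _ ec; have := yc _ ec; nra.
Qed.

Lemma E_path_compact c : compact (Ep c).
Proof.
apply: bounded_closed_compact.
  exists 1; split=> // M M1 w [w01 _ _].
  rewrite /= [leLHS]/Num.norm/= mx_normrE; apply: bigmax_le => [|[i e] _].
    by rewrite (le_trans ler01)// ltW.
  have := w01 e; rewrite [i]ord1 => /andP[w0 w1].
  by rewrite ger0_norm// (le_trans w1)// ltW.
have -> : Ep c = (\bigcap_e [set w : 'rV[R]_d | 0 <= w ord0 e]) `&`
    (\bigcap_e [set w : 'rV[R]_d | w ord0 e <= 1]) `&`
    [set w | 1 <= vertex_weight ends w N] `&`
    (\bigcap_(e in [set` c]) [set w : 'rV[R]_d | S%:R^-1 <= w ord0 e]).
  apply/seteqP; split=> w.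
    by move=> [w01 wN wc]; split=> //; split=> //; split=> // e _ /=;
      have /andP[? ?] := w01 e.
  move=> [[[w0 w1] wN] wc]; split=> // e.
  by apply/andP; split; [exact: (w0 e)|exact: (w1 e)].
apply: closedI; [apply: closedI; [apply: closedI|]|]; do ?
  (apply: closed_bigI => e _).
- exact: (preimage_closed (in1W (@coord_continuous _ 1 d ord0 e)) (@closed_ge _ _)).
- exact: (preimage_closed (in1W (@coord_continuous _ 1 d ord0 e)) (@closed_le _ _)).
- exact: (preimage_closed (in1W (@vertex_weight_continuous N)) (@closed_ge _ _)).
- exact: (preimage_closed (in1W (@coord_continuous _ 1 d ord0 e)) (@closed_ge _ _)).
Qed.

(** Since N and F differ, [c] has a first edge; it is incident to N and carries weight 1. *)
Lemma E_path_indicator c (p : pred 'I_d) : c \in self_avoiding_paths ends N F ->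
  N != F -> {subset val c <= p} -> Ep c (\row_e (p e)%:R).
Proof.
move=> cs NF cp; split.
- by move=> e; rewrite mxE; case: (p e); rewrite ?lexx ?ler01.
- move: cs; rewrite inE => /andP[/(path_first_edge NF)[e ec ie] _].
  have pe : p e by exact: (cp _ ec).
  apply: (le_trans _ (weight_le_vertex _ ie)) => [|e']; last by rewrite mxE.
  by rewrite mxE pe.
- have S0 : (0 < S)%N by apply/card_gt0P; exists c.
  move=> e ec; have pe : p e by exact: (cp _ ec).
  by rewrite mxE pe invf_le1 ?ler1n ?ltr0n.
Qed.

Variable c0 : {bseq #|V| of 'I_d}.
Hypothesis c0P : c0 \in self_avoiding_paths ends N F.
Hypothesis NF : N != F.

(** The fold starts from [Ep c0] because a [mix] with the empty set is empty. *)
Definition iter_mix (l : seq {bseq #|V| of 'I_d}) : set 'rV[R]_d :=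
  foldr mix (Ep c0) [seq Ep (val c) | c <- l].

Lemma E_path_neq0 c : c \in self_avoiding_paths ends N F -> Ep (val c) !=set0.
Proof.
by move=> cs; exists (\row_e (predT e)%:R); exact: E_path_indicator.
Qed.

Lemma iter_mix_neq0 l : {subset l <= self_avoiding_paths ends N F} ->
  iter_mix l !=set0.
Proof.
elim: l => [_|c l IH lS]; first exact: E_path_neq0.
have [b ?] := IH (fun x xl => lS _ (mem_behead (s := c :: l) xl)).
by exists b; apply: sub_mixr => //; apply: E_path_neq0; apply: lS; rewrite mem_head.
Qed.

Lemma iter_mix_sub l c : {subset l <= self_avoiding_paths ends N F} ->
  c \in l -> Ep (val c) `<=` iter_mix l.
Proof.
elim: l => [//|c' l IH lS].
have lS' x : x \in l -> x \in self_avoiding_paths ends N F.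
  by move=> xl; apply: lS; rewrite inE xl orbT.
rewrite inE => /predU1P[->|cl].
  by apply: sub_mixl; exact: iter_mix_neq0.
apply: (subset_trans (IH lS' cl)); apply: sub_mixr; apply: E_path_neq0.
by apply: lS; rewrite mem_head.
Qed.

Lemma iter_mix_convex l : @convex_set R 'rV[R]_d (iter_mix l).
Proof.
by elim: l => [|c l IH]; [|apply: mix_convex => //]; exact: E_path_convex.
Qed.

Lemma iter_mix_compact l : compact (iter_mix l).
Proof.
by elim: l => [|c l IH]; [|apply: mix_compact => //]; exact: E_path_compact.
Qed.

(** One of [t] and [1 - t] is at least 1/2. Keeping the path of the corresponding component costs a
    factor 1/2 per join. *)
Lemma iter_mix_edge l w : iter_mix l w ->
  [/\ forall e, 0 <= w ord0 e <= 1, 1 <= vertex_weight ends w N &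
  exists2 c, c \in c0 :: l &
    forall e, e \in val c -> S%:R^-1 * 2^-1 ^+ size l <= w ord0 e].
Proof.
elim: l w => [|c l IH] w.
  move=> [h1 h2 h3]; split=> //; exists c0 => [|e ec]; first by rewrite mem_head.
  by rewrite expr0 mulr1 h3.
move=> [t [a [b [/andP[t0 t1] [a01 aN ac] /IH[b01 bN [c1 c1l bc]] ->]]]].
have t1' : 0 <= 1 - t by rewrite subr_ge0.
have S0 : 0 <= S%:R^-1 :> R by rewrite invr_ge0.
have l0 : 0 <= 2^-1 ^+ size l :> R by rewrite exprn_ge0// invr_ge0.
have l1 : 2^-1 ^+ size l <= 1 :> R by rewrite exprn_ile1 ?invr_ge0// invf_le1// ler1n.
split=> [e||].
- rewrite !mxE; have := a01 e; have := b01 e.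
  by move=> /andP[? ?] /andP[? ?]; apply/andP; nra.
- by rewrite vertex_weightD !vertex_weightZ; nra.
have [t2|t2] := leP 2^-1 t.
  exists c => [|e ec]; first by rewrite !inE eqxx orbT.
  rewrite !mxE /= exprS.
  have := ac _ ec; have /andP[b0 _] := b01 e; set s := S%:R^-1 in S0 *.
  set q := 2^-1 ^+ _ in l0 l1 *.
  move=> h; have h1 : t * s <= t * a ord0 e by rewrite ler_wpM2l.
  have h2 : 0 <= (1 - t) * b ord0 e by rewrite mulr_ge0.
  have h3 : 2^-1 * s <= t * s by rewrite ler_wpM2r.
  have h4 : s * q <= s * 1 by rewrite ler_wpM2l.
  by move: h1 h2 h3 h4; rewrite mulr1 mulrCA; lra.
exists c1 => [|e ec].
  by move: c1l; rewrite !inE => /orP[->|->] //; rewrite !orbT.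
rewrite !mxE /= exprS.
have := bc _ ec; have /andP[a0 _] := a01 e.
set q := S%:R^-1 * _ => h.
have q0 : 0 <= q by rewrite mulr_ge0.
have h1 : (1 - t) * q <= (1 - t) * b ord0 e by rewrite ler_wpM2l.
have h2 : 0 <= t * a ord0 e by rewrite mulr_ge0.
have h3 : 2^-1 * q <= (1 - t) * q by rewrite ler_wpM2r//; lra.
by rewrite mulrCA -/q; lra.
Qed.

Let paths := enum (self_avoiding_paths ends N F).

(** [iter_mix paths] is convex and contains every [E_path]; conversely each join stays inside any
    convex set containing both pieces. The smallest-set definition thus becomes explicit. *)
Lemma E_hull_iter_mix : E_hull ends N F R = iter_mix paths.
Proof.
have pS : {subset paths <= self_avoiding_paths ends N F}.
  by move=> c; rewrite mem_enum.
apply/seteqP; split.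
  apply: smallest_sub; first exact: iter_mix_convex.
  by move=> w [c /= cs]; apply: iter_mix_sub => //; rewrite mem_enum.
have EpH c : c \in self_avoiding_paths ends N F ->
    Ep (val c) `<=` E_hull ends N F R.
  by move=> cs w wc; apply: sub_gen_smallest; exists c.
elim: paths pS => [_|c l IH pS]; first exact: EpH.
apply: mix_sub; first exact: convex_hull_convex.
  by apply: EpH; apply: pS; rewrite mem_head.
by apply: IH => x xl; apply: pS; rewrite inE xl orbT.
Qed.

Lemma E_hull_compact : compact (E_hull ends N F R).
Proof. by rewrite E_hull_iter_mix; exact: iter_mix_compact. Qed.

Definition E_hull_weight : R := S%:R^-1 * 2^-1 ^+ S.

Lemma E_hull_weight_gt0 : 0 < E_hull_weight.
Proof.
rewrite mulr_gt0 ?exprn_gt0 ?invr_gt0 ?ltr0n//.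
by apply/card_gt0P; exists c0.
Qed.

Lemma E_hull_edge w : E_hull ends N F R w ->
  [/\ forall e, 0 <= w ord0 e <= 1, 1 <= vertex_weight ends w N &
  exists2 c, c \in self_avoiding_paths ends N F &
    forall e, e \in val c -> E_hull_weight <= w ord0 e].
Proof.
rewrite E_hull_iter_mix => /iter_mix_edge[h1 h2 [c cl cw]]; split=> //.
exists c; last by move=> e /cw; rewrite /E_hull_weight cardE.
by move: cl; rewrite inE mem_enum => /predU1P[->|].
Qed.

End EHull.

(** * Almost sure hitting of F and scale invariance *)

Section Hitting.
Context {V : finType} {d : nat} {R : realType}.
Variables (ends : 'I_d -> V * V) (N F : V).

(* The survival probability is harmonic off F and vanishes at F, so its
   Dirichlet energy is 0. *)
Lemma survival_lim0 (w : 'rV[R]_d) : (forall e, 0 < w ord0 e) ->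
  (exists s, path_between ends N F s) ->
  avoid_lim ends F (predC1 None) w N = 0.
Proof.
move=> w_gt0 [s]; set q := avoid_lim _ _ _ _.
have w0 e : 0 <= w ord0 e by exact: ltW.
have qF : q F = 0 by rewrite /q avoid_prob_lim_F.
have : \sum_x q x * killed_laplacian ends w pred0 q x = 0.
  apply: big1 => x _; have [->|xF] := eqVneq x F; first by rewrite qF mul0r.
  transitivity (q x * 0); last exact: mulr0.
  by congr (_ * _); exact: (avoid_prob_harmonic ends (predC1 None) w0 xF).
rewrite killed_laplacian_energy => /eqP.
rewrite psumr_eq0 => [/allP H|e _]; last by rewrite mulr_ge0// sqr_ge0.
have {}H e : q (ends e).1 = q (ends e).2.
  have := H e (mem_index_enum e).
  by rewrite mulf_eq0 gt_eqF//= sqrf_eq0 subr_eq0 => /eqP.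
elim: s N => [|e s IH] x; first by rewrite /path_between /= => /eqP->.
rewrite /path_between /= => /andP[/andP[ie ps] fs].
have -> : q x = q (cross ends x e).
  move: ie; rewrite /incident /cross.
  by have [-> _|_ /= /eqP ->] := eqVneq x (ends e).1; [exact: H|exact/esym/H].
by apply: IH; rewrite /path_between ps.
Qed.

(** The outcome [None] has nonzero probability only at F, so the edges before the first [None] form
    a path to F. *)
Lemma traj_prob_path (w : 'rV[R]_d) u s : traj_prob ends F w u s != 0 ->
  None \in s -> exists2 c, path_between ends u F c &
    forall e, e \in c -> Some e \in s.
Proof.
elim: s u => [//|[e|] s IH] u /=; rewrite mulf_eq0 negb_or => /andP[p0 ps].
  rewrite inE /= => /(IH _ ps)[c pc cs]; exists (e :: c) => [|e'].
    move: p0 pc; rewrite /path_between /=; case: ifP => [/andP[_ ->]//|].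
    by rewrite eqxx.
  by rewrite !inE => /predU1P[->|/cs ->]; rewrite ?eqxx ?orbT.
move=> _; exists [::] => //.
by move: p0; rewrite pnatr_eq0 eqb0 negbK /path_between /=.
Qed.

Lemma step_probZ (a : R) (w : 'rV[R]_d) u o : a != 0 ->
  step_prob ends F (a *: w) u o = step_prob ends F w u o.
Proof.
move=> a0; case: o => [e|] //=; rewrite vertex_weightZ mxE.
by case: ifP => // _; rewrite -mulf_div divff// mul1r.
Qed.

Lemma trace_probZ (a : R) (w : 'rV[R]_d) e : a != 0 ->
  trace_prob ends N F (a *: w) e = trace_prob ends N F w e.
Proof.
move=> a0; rewrite /trace_prob; congr (limn _); apply/funext => k.
apply: eq_bigr => s _; elim: (val s) N => //= o s' IH u.
by rewrite step_probZ// IH.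
Qed.

End Hitting.

(** * Two measure-theoretic tools *)

Section MeasureTools.
Context {R : realType} {dsp : measure_display} {T : measurableType dsp}.
Variable P : probability T R.

Lemma ae_forall_countable (I : countType) (Q : I -> T -> Prop) :
  (forall i, {ae P, forall t, Q i t}) -> {ae P, forall t, forall i, Q i t}.
Proof.
move=> H.
have : {ae P, forall t, forall k, if unpickle k is Some i then Q i t else True}.
  apply: ae_foralln => k; case: unpickle => [i|]; first exact: H.
  exact: aeW.
by apply: filterS => t Ht i; have := Ht (pickle i); rewrite pickleK.
Qed.

Lemma measure_bigsetU_le (I : Type) (r : seq I) (p : pred I) (A : I -> set T) :
  (forall i, measurable (A i)) ->
  (P (\big[setU/set0]_(i <- r | p i) A i) <= \sum_(i <- r | p i) P (A i))%E.
Proof.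
move=> mA; elim: r => [|i r IH]; first by rewrite !big_nil measure0.
rewrite !big_cons; case: ifP => // _.
apply: (@le_trans _ _ (P (A i) + P (\big[setU/set0]_(j <- r | p j) A j))%E).
  by apply: measureU2 => //; exact: bigsetU_measurable.
by rewrite leeD2l.
Qed.

End MeasureTools.

(** * The ant process *)

Section Ant.
Context {R : realType} {V : finType} {d : nat}.
Variables (ends : 'I_d -> V * V) (N F : V).
Hypothesis NF : N != F.
Hypothesis connNF : exists s : seq 'I_d, path_between ends N F s.
Context {dsp : measure_display} {T : measurableType dsp}.
Variables (P : probability T R) (W : nat -> T -> 'rV[R]_d)
  (step : nat -> nat -> T -> option 'I_d).
Hypothesis antW : trace_reinforced_ant ends N F P W step.

Definition trace_event n e : set T := [set t | trace (fun k => step n k t) e].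

Lemma measurable_step n k o : measurable (step n k @^-1` [set o]).
Proof. by have [_ _ + _] := antW. Qed.

Lemma measurable_trace_event n e : measurable (trace_event n e).
Proof.
have -> : trace_event n e = \bigcup_k (step n k @^-1` [set Some e]).
  by apply/seteqP; split=> t [k]; [exists k|move=> _; exists k].
by apply: bigcup_measurable => k _; exact: measurable_step.
Qed.

Lemma measurable_cylinder n s : measurable (cylinder (step n) s).
Proof.
have -> : cylinder (step n) s =
    \bigcap_(i in `I_(size s)) (step n i @^-1` [set nth None s i]).
  apply/seteqP; split=> t /=.
    by move=> eqs i /= ilt; rewrite -[in RHS]eqs nth_mkseq.
  move=> H; apply: (@eq_from_nth _ None); rewrite size_mkseq// => i ilt.
  by rewrite nth_mkseq//; exact: H.
by apply: bigcap_measurableType => // i _; exact: measurable_step.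
Qed.

Lemma weight0 t : W 0%N t = const_mx 1. Proof. by have [->] := antW. Qed.

Lemma weightS n t e :
  W n.+1 t ord0 e = W n t ord0 e + \1_(trace_event n e) t.
Proof. by have [_ -> _ _] := antW; rewrite !indicE. Qed.

Lemma weightS_eq n t e :
  (W n.+1 t ord0 e == W n t ord0 e + 1)%:R = \1_(trace_event n e) t :> R.
Proof.
rewrite weightS indicE; case: (t \in _); first by rewrite eqxx.
by rewrite addr0 -subr_eq0 opprD addrA subrr sub0r oppr_eq0 oner_eq0.
Qed.

(** At time [n] each weight lies in {1, ..., n+1}; [f e] counts the reinforcements of [e], hence the
    successor. *)
Definition weight_value n (f : {ffun 'I_d -> 'I_n.+1}) : 'rV[R]_d :=
  \row_e (f e).+1%:R.

Lemma weight_value_inj n : injective (@weight_value n).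
Proof.
move=> f g fg; apply/ffunP => e; apply/val_inj/eqP.
have /rowP/(_ e) := fg; rewrite !mxE => /eqP.
by rewrite eqr_nat eqSS.
Qed.

Lemma weight_value_gt0 n (f : {ffun 'I_d -> 'I_n.+1}) e :
  0 < weight_value f ord0 e.
Proof. by rewrite mxE ltr0n. Qed.

Lemma weight_valueP n t : exists f : {ffun 'I_d -> 'I_n.+1},
  W n t = weight_value f.
Proof.
elim: n => [|n [f Wf]].
  by exists [ffun=> ord0]; rewrite weight0; apply/rowP => e; rewrite !mxE ffunE.
exists [ffun e => inord (f e + (t \in trace_event n e))]; apply/rowP => e.
rewrite weightS Wf !mxE ffunE inordK ?indicE ?addSn -?addn1 ?natrD//.
  by rewrite -[in RHS]addn1 !natrD addrAC.
rewrite (leq_trans (leq_add (leq_add (leqnn _) (leq_b1 _)) (leqnn 1)))//.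
by rewrite !addn1 ltnS; exact: ltn_ord.
Qed.

(** * The natural filtration and the conditional law of the trace *)

Let generators n : set (set T) :=
  [set A | exists m e (B : set R), [/\ (m <= n)%N, measurable B &
                 A = (fun t => W m t ord0 e) @^-1` B]].

Let past n := g_sigma_algebraType (generators n).

Lemma measurable_wrtP n (f : T -> R) :
  measurable_wrt (natural_filtration W n) f <->
  measurable_fun setT (f : past n -> R).
Proof.
split=> [mf _ B mB|mf B mB]; first by rewrite setTI; exact: mf.
by have := mf measurableT B mB; rewrite setTI.
Qed.

Lemma weight_measurable_wrt m n e : (m <= n)%N ->
  measurable_wrt (natural_filtration W n) (fun t => W m t ord0 e).
Proof. by move=> mn B mB; apply: sub_gen_smallest; exists m, e, B. Qed.

Lemma measurable_weight n e : measurable_fun setT (fun t => W n t ord0 e).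
Proof.
elim: n => [|n IH].
  by rewrite (_ : (fun _ => _) = cst 1)//; apply/funext => t; rewrite weight0 mxE.
rewrite (_ : (fun _ => _) = (fun t => W n t ord0 e) \+ \1_(trace_event n e)).
  by apply: measurable_funD => //; exact: measurable_indic (measurable_trace_event n e).
by apply/funext => t; rewrite weightS.
Qed.

Lemma natural_filtration_measurable n : natural_filtration W n `<=` measurable.
Proof.
apply: smallest_sub; first exact: sigma_algebra_measurable.
move=> _ [m [e [B [_ mB ->]]]].
by rewrite -[X in measurable X]setTI; exact: measurable_weight.
Qed.

Lemma natural_filtrationP : filtration (natural_filtration W).
Proof.
split=> [n|n|m n mn]; first exact: smallest_sigma_algebra.
  exact: natural_filtration_measurable.
apply: sub_smallest2r; first exact: smallest_sigma_algebra.
move=> _ [k [e [B [km mB ->]]]]; exists k, e, B; split=> //.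
exact: leq_trans mn.
Qed.

Lemma natural_filtration_weight n w : natural_filtration W n (W n @^-1` [set w]).
Proof.
have -> : W n @^-1` [set w] =
    \bigcap_(e in [set: 'I_d]) ((fun t => W n t ord0 e) @^-1` [set w ord0 e]).
  apply/seteqP; split=> [t /= <- e _ //|t H].
  by apply/rowP => e; exact: (H e I).
have H : @measurable _ (past n) (\bigcap_(e in [set: 'I_d])
    ((fun t => W n t ord0 e) @^-1` [set w ord0 e])).
  apply: fin_bigcap_measurable => // e _.
  exact: (@weight_measurable_wrt n n).
exact: H.
Qed.

Lemma natural_filtration_setI n A B : natural_filtration W n A ->
  natural_filtration W n B -> natural_filtration W n (A `&` B).
Proof.
by move=> nA nB; exact: (@measurableI _ (past n) A B).
Qed.

(** Under [P] conditioned on [C], the steps form a random walk with weights [w], so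
    [random_walk_trace] applies to that probability. A null [C] is handled separately. *)
Lemma trace_event_law n A w e : natural_filtration W n A ->
  P (A `&` (W n @^-1` [set w]) `&` trace_event n e) =
  (P (A `&` (W n @^-1` [set w])) * (trace_prob ends N F w e)%:E)%E.
Proof.
move=> nA; set C := A `&` _.
have mC : measurable C.
  apply: (@natural_filtration_measurable n); apply: natural_filtration_setI => //.
  exact: natural_filtration_weight.
have [C0|C0] := eqVneq (P C) 0%E.
  rewrite C0 mul0e; apply/eqP; rewrite -measure_le0 -C0 le_measure ?inE//.
  by apply: measurableI => //; exact: measurable_trace_event.
have fC : P C \is a fin_num by exact: fin_num_measure.
(* The last argument is the fallback when the mass of [C] is 0 or infinite, both excluded here. *)
pose P' : probability T R := mnormalize (mrestr P mC) P.
have P'E U : P' U = (P (C `&` U) * (fine (P C))^-1%:E)%E.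
  have Coo : (P C == +oo%E) = false.
    by apply/negP => /eqP Coo; move: fC; rewrite Coo.
  have -> : P' U = ((if (P ([set: T] `&` C) == 0) || (P ([set: T] `&` C) == +oo)
    then fun U => P U
    else fun U => P (U `&` C) * (fine (P ([set: T] `&` C)))^-1%:E) U)%E by [].
  by rewrite setTI (negPf C0) Coo setIC.
have fC0 : fine (P C) != 0 by rewrite fine_eq0.
have rw : random_walk ends N F P' w (step n).
  split=> [k o|s]; first exact: measurable_step.
  have [_ _ _ law] := antW; rewrite [LHS]P'E law// -/C.
  by rewrite -(fineK fC) -!EFinM mulrAC divff// mul1r.
have := random_walk_trace e rw; rewrite [LHS]P'E => <-.
have PC1 : (P C * (fine (P C))^-1%:E = 1)%E.
  by rewrite -[X in (X * _)%E](fineK fC) -EFinM divff.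
by rewrite muleCA PC1 mule1.
Qed.

(** * Invariance of the hull *)

Lemma trajectory_ae n (f : {ffun 'I_d -> 'I_n.+1}) s :
  {ae P, forall t, W n t = weight_value f -> cylinder (step n) s t ->
     traj_prob ends F (weight_value f) N s != 0}.
Proof.
have [p0|p0] := eqVneq (traj_prob ends F (weight_value f) N s) 0; last exact: aeW.
exists (W n @^-1` [set weight_value f] `&` cylinder (step n) s); split.
- apply: measurableI; last exact: measurable_cylinder.
  apply: (@natural_filtration_measurable n); exact: natural_filtration_weight.
- have [_ _ _ law] := antW.
  have := @law n setT (weight_value f) s; rewrite !setTI p0 mule0; apply.
  exact: (@measurableT _ (past n)).
- move=> t /= /not_implyP[Wt] /not_implyP[ct _]; by split.
Qed.

(** The exceptional event lies in every [U k], whose probability is at most that of surviving [k]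
    steps. This tends to 0 by [survival_lim0], all weights being positive. *)
Lemma hitting_ae n (f : {ffun 'I_d -> 'I_n.+1}) :
  {ae P, forall t, W n t = weight_value f -> exists k, step n k t = None}.
Proof.
pose w := weight_value f.
pose D s := W n @^-1` [set w] `&` cylinder (step n) s.
pose U k := \big[setU/set0]_(s : k.-tuple (option 'I_d) | all (predC1 None) s) D s.
have mD s : measurable (D s).
  apply: measurableI; last exact: measurable_cylinder.
  by apply: (@natural_filtration_measurable n); exact: natural_filtration_weight.
have mU k : measurable (U k) by apply: bigsetU_measurable => s _; exact: mD.
have PU k : (P (U k) <= (avoid_prob ends F (predC1 None) w k N)%:E)%E.
  apply: (le_trans (measure_bigsetU_le P _ _ (fun s : k.-tuple _ => mD s))).
  rewrite /avoid_prob -sumEFin; apply: lee_sum => s _.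
  have [_ _ _ law] := antW.
  have := @law n setT w s; rewrite !setTI => ->; last first.
    exact: (@measurableT _ (past n)).
  rewrite -[leRHS]mul1e; apply: lee_wpmul2r.
    rewrite lee_fin; elim: (val s) N => //= o s' IH u; rewrite mulr_ge0//.
    case: o => [e|] //=; case: ifP => // _.
    by rewrite divr_ge0// ?vertex_weight_ge0// => [|e']; rewrite ltW ?weight_value_gt0.
  apply: probability_le1.
  by apply: (@natural_filtration_measurable n); exact: natural_filtration_weight.
exists (\bigcap_k U k); split; first exact: bigcapT_measurable.
- apply/eqP; rewrite -measure_le0.
  have fU : P (\bigcap_k U k) \is a fin_num.
    by apply: fin_num_measure; exact: bigcapT_measurable.
  have w0 e : 0 <= w ord0 e by rewrite ltW ?weight_value_gt0.
  apply: (@le_trans _ _ (fine (P (\bigcap_k U k)))%:E); first by rewrite fineK.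
  rewrite lee_fin.
  rewrite -(@survival_lim0 _ _ _ ends N F w (weight_value_gt0 f) connNF).
  apply: limr_ge; first exact: avoid_prob_cvg.
  apply: nearW => k; rewrite -lee_fin fineK//.
  apply: le_trans (PU k); apply: le_measure; rewrite ?inE//.
    exact: bigcapT_measurable.
  by move=> t; exact.
- move=> t /= /not_implyP[Wt nE] k _; rewrite /U.
  have sz : size (mkseq (fun j => step n j t) k) == k by rewrite size_mkseq.
  have nN : all (predC1 None) (Tuple sz).
    apply/allP => _ /= /mapP[j _ ->]; apply/eqP => stepN.
    by apply: nE; exists j.
  rewrite (bigD1 (Tuple sz)) //=; left; split=> //.
  by rewrite /cylinder /= size_mkseq.
Qed.

Lemma trace_path_ae n : {ae P, forall t, exists2 s, path_between ends N F s &
  forall e, e \in s -> trace_event n e t}.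
Proof.
(* Weight values and finite trajectories are countable in number, so one null set serves them
   all. *)
have H1 := ae_forall_countable (fun f => ae_forall_countable (@trajectory_ae n f)).
have H2 := ae_forall_countable (@hitting_ae n).
move: H1 H2; apply: filterS2 => t H1 H2.
have [f Wf] := weight_valueP n t; have [k kN] := H2 _ Wf.
(* Length [k.+1], so that the outcome [None] at index [k] is included. *)
pose s := mkseq (fun j => step n j t) k.+1.
have cs : cylinder (step n) s t by rewrite /cylinder /mkset /s size_mkseq.
have Ns : None \in s.
  by apply/mapP; exists k => //; rewrite mem_iota/= add0n.
have [c pc cP] := traj_prob_path (H1 _ _ Wf cs) Ns.
by exists c => // e /cP /mapP[j _ ej]; exists j.
Qed.

Lemma rescaledS n t : rescaled W n.+1 t = (n.+1%:R / n.+2%:R) *: rescaled W n t +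
  (1 - n.+1%:R / n.+2%:R) *: \row_e (t \in trace_event n e)%:R.
Proof.
apply/rowP => e; rewrite !mxE weightS indicE.
have n1 : n.+1%:R != 0 :> R by rewrite pnatr_eq0.
have n2 : n.+2%:R != 0 :> R by rewrite pnatr_eq0.
by move: n1 n2; rewrite -!natr1 => n1 n2; field; rewrite n1 n2.
Qed.

Lemma rescaled_E_hull n : {ae P, forall t, E_hull ends N F R (rescaled W n t)}.
Proof.
have sub c : c \in self_avoiding_paths ends N F ->
    E_path ends N F (val c) `<=` E_hull ends N F R.
  by move=> cs w wc; apply: sub_gen_smallest; exists c.
elim: n => [|n IH].
  apply: aeW => t; have [s /self_avoiding_subpath[c cs _]] := connNF.
  apply: (sub c cs).
  have -> : rescaled W 0 t = \row_e (predT e)%:R.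
    by apply/rowP => e; rewrite !mxE weight0 mxE invr1 mulr1.
  by apply: E_path_indicator.
move: IH (trace_path_ae n); apply: filterS2 => t Ht [s ps sT].
rewrite rescaledS; have /convex_setP cH : @convex_set R 'rV[R]_d (E_hull ends N F R).
  exact: convex_hull_convex.
apply: cH => //.
- have [c cs sc] := self_avoiding_subpath ps.
  apply: (sub c cs); apply: E_path_indicator => // e ec.
  by rewrite unfold_in; apply/mem_set; apply: sT; exact: sc.
- rewrite divr_ge0//= ler_pdivrMr ?ltr0n// mul1r ler_nat.
  by [].
Qed.

(** * The martingale increments *)

Lemma bigsetU_weight_value n A :
  \big[setU/set0]_(f <- enum {ffun 'I_d -> 'I_n.+1})
    (A `&` (W n @^-1` [set weight_value f])) = A.
Proof.
apply/seteqP; split=> t.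
  by elim/big_ind: _ => // [B C hB hC [/hB|/hC]//|f _ []].
move=> At; have [f Wf] := weight_valueP n t.
by rewrite (bigD1_seq f) ?mem_enum ?enum_uniq//=; left; split.
Qed.

(** As [W n] takes finitely many values, the preimage is a finite union of level sets of [W n]. *)
Lemma measurable_wrt_weight n (g : 'rV[R]_d -> R) :
  measurable_wrt (natural_filtration W n) (fun t => g (W n t)).
Proof.
move=> B mB; rewrite -(bigsetU_weight_value n (_ @^-1` B)).
have : @measurable _ (past n) (\big[setU/set0]_(f <- enum {ffun 'I_d -> 'I_n.+1})
    ((fun t => g (W n t)) @^-1` B `&` (W n @^-1` [set weight_value f]))).
  apply: bigsetU_measurable => f _.
  have [Bf|Bf] := pselect (B (g (weight_value f))).
    rewrite (_ : _ `&` _ = W n @^-1` [set weight_value f]).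
      exact: natural_filtration_weight.
    by apply/seteqP; split=> t [] //= Wt; split; rewrite //= ?Wt.
  rewrite (_ : _ `&` _ = set0) //.
  by rewrite -subset0 => t [/= + Wt]; rewrite Wt.
exact.
Qed.

Lemma trace_event_measurable_wrt n e :
  measurable_wrt (natural_filtration W n.+1) (\1_(trace_event n e) : T -> R).
Proof.
apply/measurable_wrtP.
rewrite (_ : \1_(trace_event n e) =
    (fun t => W n.+1 t ord0 e) \- (fun t => W n t ord0 e)).
  apply: (@measurable_funB _ (past n.+1)); apply/measurable_wrtP.
    exact: weight_measurable_wrt.
  by apply: weight_measurable_wrt.
by apply/funext => t /=; rewrite weightS addrAC subrr add0r.
Qed.

Lemma weight_integrable n (g : 'rV[R]_d -> R) :
  P.-integrable setT (EFin \o (fun t => g (W n t))).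
Proof.
apply: measurable_bounded_integrable => //.
- by rewrite (le_lt_trans (probability_le1 _ _))// ltry.
- move=> _ B mB; rewrite setTI; apply: (@natural_filtration_measurable n).
  exact: measurable_wrt_weight.
- exists (\sum_(f : {ffun 'I_d -> 'I_n.+1}) `|g (weight_value f)|).
  split=> [|M hM t _]; first exact: num_real.
  have [f Wf] := weight_valueP n t; rewrite /= Wf.
  rewrite (le_trans _ (ltW hM))// (bigD1 f)//= lerDl.
  by apply: sumr_ge0.
Qed.

(** Evaluated at [W n], where the conditional law is stated; [trace_probZ] transfers it to the
    rescaled weights. *)
Definition noise n e t : R :=
  \1_(trace_event n e) t - trace_prob ends N F (W n t) e.

Lemma noise_measurable_wrt n e :
  measurable_wrt (natural_filtration W n.+1) (noise n e).
Proof.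
apply/measurable_wrtP; apply: (@measurable_funB _ (past n.+1)).
  by apply/measurable_wrtP; exact: trace_event_measurable_wrt.
apply/measurable_wrtP => B mB.
have [_ _ mono] := natural_filtrationP; apply: (mono n) => //.
exact: (@measurable_wrt_weight n (fun w => trace_prob ends N F w e) B mB).
Qed.

Lemma noise_integrable n e : P.-integrable setT (EFin \o noise n e).
Proof.
rewrite (_ : _ \o _ = (fun t => (\1_(trace_event n e) t : R)%:E) \-
    (EFin \o (fun t => trace_prob ends N F (W n t) e)))%E//.
apply: integrableB => //; last first.
  exact: (weight_integrable n (fun w => trace_prob ends N F w e)).
by apply: integrable_indic; exact: measurable_trace_event.
Qed.

(** On each piece [C] of [A] where [W n] is constant, the subtracted probability is a constant [p],
    and both parts of the noise integrate to [P C * p] by [trace_event_law]. *)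
Lemma noise_integral0 n e A : natural_filtration W n A ->
  (\int[P]_(t in A) (noise n e t)%:E = 0)%E.
Proof.
move=> nA; rewrite -{1}(bigsetU_weight_value n A).
have mC f : measurable (A `&` (W n @^-1` [set @weight_value n f])).
  apply: (@natural_filtration_measurable n); apply: natural_filtration_setI => //.
  exact: natural_filtration_weight.
rewrite integral_bigsetU_EFin//; last first.
- have /integrableP[+ _] := noise_integrable n e.
  by apply: measurable_funS => //; exact: bigsetU_measurable.
- apply/trivIsetP => f g _ _ fg; rewrite -subset0 => t [[_ /= Wf] [_ /= Wg]].
  by move/eqP : fg; apply; apply: weight_value_inj; rewrite -Wf.
- exact: enum_uniq.
apply: big1 => f _; have := mC f; set C := A `&` _ => mCf.
pose p := trace_prob ends N F (weight_value f) e.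
transitivity (\int[P]_(t in C) ((\1_(trace_event n e) t)%:E - (cst p t)%:E))%E.
  by apply: eq_integral => t; rewrite inE => -[_ /= Wt]; rewrite /noise Wt EFinB.
have mtr := measurable_trace_event n e.
rewrite integralB_EFin//; last first.
- exact: (finite_measure_integrable_cst P p mCf).
- by apply: (integrableS measurableT) => //; exact: (integrable_indic P mtr).
have -> : (\int[P]_(x in C) (\1_(trace_event n e) x)%:E = P C * p%:E)%E.
  by rewrite integral_indic// setIC; exact: trace_event_law.
have -> : (\int[P]_(x in C) (cst p x)%:E = P C * p%:E)%E.
  by rewrite muleC; exact: (integral_cst P mCf p%:E).
by rewrite subee// fin_numM// fin_num_measure.
Qed.

End Ant.

(** * Lipschitz continuity of Q and assembly of the decomposition *)

Lemma Q_lipschitz (R : realType) (V : finType) (d : nat)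
    (ends : 'I_d -> V * V) (N F : V) : N != F ->
  (exists s : seq 'I_d, path_between ends N F s) ->
  [lipschitz Q ends N F w | w in E_hull ends N F R].
Proof.
move=> NF [s /self_avoiding_subpath[c0 c0P _]].
pose K : R := @green_bound d R #|V| (E_hull_weight ends N F) * (#|V| * d)%:R.
(* The all-ones vector shows that the hull is inhabited, so the filter given to [klipschitzW] is
   proper. In the constant [K + 1], [K] accounts for p_e and 1 for w_e. *)
have K1 : E_hull ends N F R (\row_e (predT e)%:R).
  by apply: sub_gen_smallest; exists c0 => //; exact: E_path_indicator.
have K2 : (E_hull ends N F R `*` E_hull ends N F R)
  (\row_e (predT e)%:R, \row_e (predT e)%:R) by [].
apply: (@klipschitzW _ _ _ (K + 1) _ _ (globally_properfilter K2)).
move=> [w w'] /= [Kw Kw'].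
have [w01 wN [c cs cw]] := E_hull_edge c0P NF Kw.
have [w01' wN' _] := E_hull_edge c0P NF Kw'.
have /andP[pc _] : path_between ends N F c && uniq (visited ends N c).
  by move: cs; rewrite inE.
have H e := trace_prob_lipschitz e NF w01 w01' wN wN'
  (E_hull_weight_gt0 c0P) (size_bseq c) pc cw.
(* The sup norm is a maximum with default 0, so nonnegativity is required; it is read off from [H]
   at an edge of the path. *)
have K0 : 0 <= (K + 1) * `|w - w'|.
  have [e _ _] := path_first_edge NF pc.
  by rewrite mulrDl mul1r addr_ge0// (le_trans (normr_ge0 _) (H e)).
rewrite [leLHS]/Num.norm/= mx_normrE; apply: bigmax_le => // -[i e] _ /=.
rewrite [i]ord1 !mxE.
have h : `|w ord0 e - w' ord0 e| <= `|w - w'|.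
  rewrite [leRHS]/Num.norm/= mx_normrE.
  by apply: le_trans (le_bigmax _ _ (ord0, e)); rewrite !mxE.
set p := trace_prob _ _ _ w e; set p' := trace_prob _ _ _ w' e.
have -> : p - w ord0 e - (p' - w' ord0 e) = (p - p') - (w ord0 e - w' ord0 e) by ring.
rewrite mulrDl mul1r (le_trans (ler_normB _ _))// lerD//.
exact: H.
Qed.

Theorem proposition2p7 (R : realType) (V : finType) (d : nat)
    (ends : 'I_d -> V * V) (N F : V) (NF : N != F)
    (connNF : exists s : seq 'I_d, path_between ends N F s)
    (dsp : measure_display) (T : measurableType dsp) (P : probability T R)
    (W : nat -> T -> 'rV[R]_d) (step : nat -> nat -> T -> option 'I_d)
    (antW : trace_reinforced_ant ends N F P W step)
    (xi : nat -> T -> 'rV[R]_d)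
    (xiE : forall n t e, xi n.+1 t ord0 e =
       (W n.+1 t ord0 e == W n t ord0 e + 1)%:R -
       trace_prob ends N F (rescaled W n t) e) :
  [/\ [lipschitz Q ends N F w | w in E_hull ends N F R],
      stochastic_approximation P (natural_filtration W)
        (E_hull ends N F R) (Q ends N F) (rescaled W),
      forall n, {ae P, forall t, E_hull ends N F R (rescaled W n t)},
      forall n t, rescaled W n.+1 t = rescaled W n t +
        n.+2%:R^-1 *: (Q ends N F (rescaled W n t) + xi n.+1 t) &
      sa_decomposition P (natural_filtration W)
        (E_hull ends N F R) (Q ends N F) (rescaled W) xi (fun _ _ => 0)].
Proof.
have lipQ := @Q_lipschitz R _ _ ends _ _ NF connNF.
have aeK := rescaled_E_hull NF connNF antW.
have mW := @measurable_wrt_weight _ _ _ _ _ _ _ _ _ _ _ antW.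
have xi_noise n e : (fun t => xi n.+1 t ord0 e) = noise ends N F W step n e.
  apply/funext => t; rewrite xiE (weightS_eq antW) /noise /rescaled.
  by rewrite trace_probZ// invr_eq0 pnatr_eq0.
have rec n t : rescaled W n.+1 t = rescaled W n t +
    n.+2%:R^-1 *: (Q ends N F (rescaled W n t) + xi n.+1 t).
  apply/rowP => e; rewrite !mxE xiE (weightS_eq antW) (weightS antW).
  set a := trace_prob _ _ _ _ _; set b := \1_ _ _.
  have n1 : n.+1%:R != 0 :> R by rewrite pnatr_eq0.
  have n2 : n.+2%:R != 0 :> R by rewrite pnatr_eq0.
  by move: n1 n2; rewrite -!natr1 => n1 n2; field; rewrite n1 n2.
have [s /self_avoiding_subpath[c0 c0P _]] := connNF.
have saQ : sa_decomposition P (natural_filtration W)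
    (E_hull ends N F R) (Q ends N F) (rescaled W) xi (fun _ _ => 0).
  split.
  - split=> [|n e]; first exact: natural_filtrationP antW.
    have -> : (fun t => rescaled W n t ord0 e) = (fun t => n.+1%:R^-1 * W n t ord0 e).
      by apply/funext => t; rewrite mxE.
    exact: (mW n (fun w => n.+1%:R^-1 * w ord0 e)).
  - split=> //; first exact: convex_hull_convex.
    exact: (E_hull_compact c0P).
  - move=> n e; rewrite xi_noise; split.
      exact: (noise_measurable_wrt antW).
    split.
    + exact: (noise_integrable antW).
    + exact: integrable0.
    + exact: (mW n (cst 0)).
    + by move=> A nA; rewrite (noise_integral0 antW e nA) integral0.
  - split.
      move=> n e.
      exact: (mW n (fun=> (0 : 'rV[R]_d) ord0 e)).
    exists 1 => // n n0; apply: aeW => t.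
    by rewrite normr0 divr_ge0.
  - by move=> n t; rewrite addr0.
split=> //.
by exists xi, (fun _ _ => 0).
Qed.
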